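(* The c.s.r. recognition problem for a pair of nonnegative rational matrices is algorithmically undecidable: there is no algorithm which, for every $d$ and every pair $\mathcal A=\{A_1,A_2\}$ of $d\times d$ matrices with nonnegative rational entries, decides within finite time whether the semigroup $\mathcal S_{\mathcal A}$ is c.s.r.
   Context: $\mathcal S_{\mathcal A}$ denotes the semigroup generated by $\mathcal A$ by multiplications and taking closure. A matrix semigroup is c.s.r. (has constant spectral radius) if the spectral radius (maximal modulus of eigenvalues) of all its elements is the same and nonzero. *)

(* Defs.v *)
From HB Require Import structures.
From mathcomp Require Import all_boot all_order all_algebra.
From mathcomp Require Import boolp classical_sets reals topology normedtype.
From mathcomp Require Import complex.

Set Implicit Arguments.
Unset Strict Implicit.
Unset Printing Implicit Defensive.

Import Order.TTheory GRing.Theory Num.Theory.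
Import numFieldNormedType.Exports.

Local Open Scope classical_set_scope.
Local Open Scope ring_scope.

(* "Algorithm" is read as partial (mu-)recursive function (Kleene).
   [murec n] is the syntax of the n-ary ones. *)
Inductive murec : nat -> Type :=
| MZero n : murec n
| MSucc : murec 1
| MProj n : 'I_n -> murec n
| MComp k n : murec k -> ('I_k -> murec n) -> murec n
| MPrec n : murec n -> murec n.+2 -> murec n.+1
| MMin n : murec n.+1 -> murec n.

(* [murec_eval f v y]: f is defined at v, with value y.
   Primitive recursion is on the first argument:
     F (0, v) = f v,  F (m + 1, v) = g (m, F (m, v), v);
   minimization is the unbounded search for the least y with f (y, v) = 0,
   which is undefined unless f (i, v) is defined for every i < y. *)
Fixpoint murec_eval n (f : murec n) : n.-tuple nat -> nat -> Prop :=
  match f in murec n return n.-tuple nat -> nat -> Prop with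
  | MZero _ => fun _ y => y = 0%N
  | MSucc => fun v y => y = (thead v).+1
  | MProj _ i => fun v y => y = tnth v i
  | MComp k _ f g => fun v y => exists w : k.-tuple nat,
      (forall i, murec_eval (g i) v (tnth w i)) /\ murec_eval f w y
  | MPrec n f g => fun v =>
      (fix rec (m : nat) (y : nat) : Prop :=
         if m is m'.+1 then
           exists2 z, rec m' z & murec_eval g [tuple of m' :: z :: behead v] y
         else murec_eval f [tuple of behead v] y) (thead v)
  | MMin _ f => fun v y =>
      murec_eval f [tuple of y :: v] 0 /\
      forall i, (i < y)%N -> exists z, murec_eval f [tuple of i :: v] z.+1
  end.

(* Input code of a matrix pair: the natural number coding the finite sequence
   d, entries of A1, entries of A2, with entries listed row by row, each entry
   as its numerator and denominator in lowest terms. Numerators are stored by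
   absolute value, so the code is faithful on nonnegative matrices only. *)
Definition rat_code (x : rat) : seq nat := [:: `|numq x|%N; `|denq x|%N].

Definition mx_code d (A : 'M[rat]_d) : seq nat :=
  flatten [seq rat_code (A i j) | i <- enum 'I_d, j <- enum 'I_d].

Definition pair_code d (A1 A2 : 'M[rat]_d) : nat :=
  CodeSeq.code (d :: mx_code A1 ++ mx_code A2).

Definition mx_nonneg d (A : 'M[rat]_d) : Prop := forall i j, 0 <= A i j.

Section Semigroup.
Variables (R : realType) (d : nat).

Inductive mx_products (F : set 'M[R]_d) : set 'M[R]_d :=
| mx_products_gen A : F A -> mx_products F A
| mx_products_mul A B :
    mx_products F A -> mx_products F B -> mx_products F (A *m B).

Definition mx_semigroup (F : set 'M[R]_d) : set 'M[R]_d :=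
  closure (mx_products F).

(* For d > 0 the set is finite and nonempty, so the supremum is a maximum. *)
Definition spectral_radius (A : 'M[R]_d) : R :=
  sup [set r : R | exists2 z : R[i],
         eigenvalue (map_mx (real_complex R) A) z & r = Normc.normc z].

Definition csr (S : set 'M[R]_d) : Prop :=
  exists2 r : R, r != 0 & forall A, S A -> spectral_radius A = r.

End Semigroup.

Definition rat_pair (R : realType) d (A1 A2 : 'M[rat]_d) : set 'M[R]_d :=
  [set map_mx ratr A1; map_mx ratr A2].
Arguments rat_pair R {d} A1 A2.

(* Main.v *)
From HB Require Import structures.
Require Import Defs.
From mathcomp Require Import all_boot all_order all_algebra zify ring.
From mathcomp Require Import boolp classical_sets reals topology normedtype complex.

Set Implicit Arguments.
Unset Strict Implicit.
Unset Printing Implicit Defensive.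

Import Order.TTheory GRing.Theory Num.Theory numFieldNormedType.Exports.

(* A partial recursive function is compiled into a nondeterministic register
   program, all of whose instructions are linear updates of the store or equality
   tests. A word over two letters resolves the nondeterminism, so each letter acts
   linearly on the products of pairs of registers, and the sum of the squared
   errors (s x - s y)^2 of the tests met along a run is linear in them as well.
   After rescaling by a constant and adding a slack coordinate, both letters act by
   stochastic matrices, except at the end of the program, where all the mass is sent
   back to the initial state with weights that multiply it by 1 + c (1 - E), where
   c > 0 and E is the accumulated error. If the program can halt without error,
   some product has an eigenvalue > 1, and its powers have unbounded spectral
   radius. Otherwise E >= 1 for all complete runs, the entries of all products
   are bounded by 2, and all spectral radii in the closure are equal to 1, the
   eigenvalue of an isolated fixed state.

   The input n only occurs in four entries, whose place in the code of the pair is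
   known. So the program built from a decision procedure f can compute the code
   of its own matrix pair from the input encoding the other entries, and halt
   exactly when f answers 1: f cannot be correct on this pair. *)

(** * Register programs *)

Definition store := nat -> nat.

Definition upd (s : store) x v : store := fun y => if y == x then v else s y.

(** No constants are provided: register 0 permanently holds 1 and supplies them. *)
Inductive op := Zero of nat | Add of nat & nat | Test of nat & nat.

Definition op_ok (a : op) (s : store) : bool :=
  if a is Test x y then s x == s y else true.

Definition op_upd (a : op) (s : store) : store :=
  match a with
  | Zero x => upd s x 0
  | Add x y => upd s x (s x + s y)
  | Test _ _ => s
  end.

(** There is no conditional. [Star] iterates an arbitrary number of times, and a later [Test]
    discards the executions whose guesses were wrong. *)
Inductive com := Op of op | Seq of com & com | Star of com.

Fixpoint iter_rel (r : store -> store -> Prop) k s s' : Prop :=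
  if k is k'.+1 then exists2 t, iter_rel r k' s t & r t s' else s' = s.

Fixpoint exec (c : com) (s s' : store) : Prop :=
  match c with
  | Op a => op_ok a s /\ s' = op_upd a s
  | Seq c1 c2 => exists2 t, exec c1 s t & exec c2 t s'
  | Star c1 => exists k, iter_rel (exec c1) k s s'
  end.

Notation "c1 ;; c2" := (Seq c1 c2) (at level 81, right associativity).

Definition Copy x y := Op (Zero x) ;; Op (Add x y).
Definition Inc x := Op (Add x 0).

(* Compiles [f] to a program reading its arguments from the registers [args],
   leaving the result in register [b] and writing only registers >= [b]. *)
Fixpoint compile n (f : murec n) (args : seq nat) (b : nat) : com :=
  match f with
  | MZero _ => Op (Zero b)
  | MSucc => Copy b (head 0 args) ;; Inc b
  | MProj _ i => Copy b (nth 0 args i)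
  | MComp k _ f g =>
      foldr (fun i c => compile (g i) args (b.+1 + i) ;; c)
            (compile f (iota b.+1 k) (b.+1 + k) ;; Copy b (b.+1 + k)) (enum 'I_k)
  | MPrec _ f g =>
      compile f (behead args) b.+2 ;; Copy b b.+2 ;; Op (Zero b.+1) ;;
      Star (compile g [:: b.+1, b & behead args] b.+2 ;; Copy b b.+2 ;; Inc b.+1) ;;
      Op (Test b.+1 (head 0 args))
  | MMin _ f =>
      Op (Zero b) ;;
      Star (compile f (b :: args) b.+1 ;;
            Op (Zero b.+2) ;; Inc b.+2 ;; Star (Inc b.+2) ;;
            Op (Test b.+2 b.+1) ;; Inc b) ;;
      compile f (b :: args) b.+1 ;; Op (Zero b.+2) ;; Op (Test b.+1 b.+2)
  end.

Definition prec_eval (F : nat -> Prop) (G : nat -> nat -> nat -> Prop) :=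
  fix rec (m y : nat) : Prop :=
    if m is m'.+1 then exists2 z, rec m' z & G m' z y else F y.

Lemma murec_eval_precE n (f : murec n) (g : murec n.+2) (v : n.+1.-tuple nat) y :
  murec_eval (MPrec f g) v y =
  prec_eval (murec_eval f [tuple of behead v])
    (fun m z => murec_eval g [tuple of m :: z :: behead v]) (thead v) y.
Proof. reflexivity. Qed.

Lemma murec_eval_fun n (f : murec n) v y y' :
  murec_eval f v y -> murec_eval f v y' -> y = y'.
Proof.
elim: n / f v y y' => [n||n i|k n f IHf g IHg|n f IHf g IHg|n f IHf] v y y'.
- by move=> /= -> ->.
- by move=> /= -> ->.
- by move=> /= -> ->.
- move=> [w [gw fw]] [w' [gw' fw']].
  have ww : w = w' by apply/eq_from_tnth => i; apply: IHg (gw i) (gw' i).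
  by rewrite -ww in fw'; apply: IHf fw fw'.
- rewrite !murec_eval_precE; elim: (thead v) y y' => [|m IHm] y y' /=; first exact: IHf.
  by move=> [z /IHm zE gz] [z' /zE <-]; apply: IHg.
- move=> /= [f0 lt0] [f0' lt0'].
  case: (ltngtP y y') => // ly.
    by case: (lt0' _ ly) => z /(IHf _ _ _ f0).
  by case: (lt0 _ ly) => z /(IHf _ _ _ f0').
Qed.

Lemma map_agree (s s' : store) b args : all (fun x => x < b) args ->
  (forall r, r < b -> s' r = s r) -> map s' args = map s args.
Proof. by move=> /allP argsb ss; apply/eq_in_map => x /argsb /ss. Qed.

Lemma updE s x v y : upd s x v y = if y == x then v else s y.
Proof. reflexivity. Qed.

Lemma exec_Copy x y s s' : x <> y ->
  exec (Copy x y) s s' -> s' x = s y /\ forall r, r <> x -> s' r = s r.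
Proof.
move=> /eqP xy [t [_ ->] [_ ->]] /=.
split; rewrite /upd ?eqxx ?[y == x]eq_sym ?(negbTE xy) //.
by move=> r /eqP/negbTE ->.
Qed.

Lemma exec_Copy_ex x y s : exists s', exec (Copy x y) s s'.
Proof. by eexists; exists (upd s x 0). Qed.

Lemma exec_Inc x s s' : s 0 = 1 ->
  exec (Inc x) s s' -> s' x = (s x).+1 /\ forall r, r <> x -> s' r = s r.
Proof.
move=> s0 [_ ->] /=; rewrite s0 addn1.
split; rewrite /upd ?eqxx // => r /eqP/negbTE -> //.
Qed.

(** This is partial correctness: whatever guesses succeed, the result is right. Keeping the
    registers below [b] intact preserves the arguments, the earlier results and the constant in
    register 0. *)
Lemma compile_sound n (f : murec n) args b s s' :
  s 0 = 1 -> 0 < b -> all (fun x => x < b) args -> exec (compile f args b) s s' ->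
  (forall v, tval v = map s args -> murec_eval f v (s' b)) /\
  (forall r, r < b -> s' r = s r).
Proof.
have allW c c' l : all (fun x => x < c) l -> c <= c' -> all (fun x => x < c') l.
  by move=> lc cc; apply: sub_all lc => x /leq_trans; apply.
elim: n / f args b s s' => [n||n i|k n f IHf g IHg|n f IHf g IHg|n f IHf] args b s s' s0 b0 argsb.
- move=> [_ ->] /=; split=> [v _|r rb]; rewrite /upd ?eqxx //.
  by rewrite ltn_eqF.
- move=> [t tC /exec_Inc]; case: (ltnP 0 (size args)) => [sz|sz].
    have hb : head 0 args < b.
      by move/allP: argsb; apply; case: (args) sz => //= *; rewrite mem_head.
    have [|tb tr] := exec_Copy _ tC; first by lia.
    rewrite tr; last by lia.
    move=> /(_ s0) [s'b s'r]; split=> [v vE|r rb].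
      rewrite s'b tb /= /thead (tnth_nth 0) vE.
      by case: (args) sz.
    by rewrite s'r ?tr //; lia.
  have [|tb tr] := exec_Copy _ tC; first by case: (args) sz => //=; lia.
  rewrite tr; last by lia.
  move=> /(_ s0) [s'b s'r]; split=> [v vE|r rb].
    by have := size_tuple v; rewrite vE size_map; lia.
  by rewrite s'r ?tr //; lia.
- have nb : nth 0 args i < b.
    case: (ltnP i (size args)) => [isz|/(nth_default 0) -> //].
    by move/allP: argsb; apply; rewrite mem_nth.
  move=> /exec_Copy; case; first by lia.
  move=> s'b s'r; split=> [v vE|r rb]; last by rewrite s'r //; lia.
  rewrite s'b /= (tnth_nth 0) vE (nth_map 0) //.
  by rewrite -(size_map s) -vE size_tuple.
- move=> ex.
  pose D := foldr (fun i c => compile (g i) args (b.+1 + i) ;; c)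
            (compile f (iota b.+1 k) (b.+1 + k) ;; Copy b (b.+1 + k)).
  (* After the first [j] argument programs, the registers from [b.+1] on hold the first [j] values;
     the induction is on the number of programs left. *)
  have key j t : j <= k -> (forall r, r < b -> t r = s r) ->
      (forall v, tval v = map s args -> forall i : 'I_k, i < j -> murec_eval (g i) v (t (b.+1 + i))) ->
      exec (D (drop j (enum 'I_k))) t s' ->
      (forall v, tval v = map s args -> murec_eval (MComp f g) v (s' b)) /\
      (forall r, r < b -> s' r = s r).
    move: {2}(k - j) (leqnn (k - j)) => m; elim: m j t => [|m IHm] j t km jk ts gt.
      have -> : j = k by lia.
      rewrite drop_oversize ?size_enum_ord //= => -[u tu us'].
      have [|||uf ur] := IHf _ _ _ _ _ _ _ tu; first by rewrite ts.
      - by [].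
      - by apply/allP => x; rewrite mem_iota; lia.
      have [|s'b s'r] := exec_Copy _ us'; first by lia.
      split=> [v vE|r rb]; last by rewrite s'r ?ur ?ts //; lia.
      exists [tuple t (b.+1 + i) | i < k]; split.
        by move=> i; rewrite tnth_mktuple; apply: gt => //; have := ltn_ord i; lia.
      rewrite s'b; apply: uf => /=.
      have -> : iota b.+1 k = [seq b.+1 + i | i <- iota 0 k] by rewrite -iotaDl addn0.
      rewrite -val_enum_ord -!map_comp.
      by apply: eq_map => i /=; lia.
    case: (ltnP j k) => jk'; last by apply: (IHm j) => //; lia.
    rewrite (drop_nth (Ordinal jk')) ?size_enum_ord //=.
    set ii := nth _ _ _; have iiE : ii = j :> nat by rewrite nth_enum_ord.
    move=> [u tu us'].
    have [|||ug ur] := IHg _ _ _ _ _ _ _ _ tu.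
    - by rewrite ts.
    - by [].
    - by apply: allW argsb _; lia.
    apply: (IHm j.+1 u) us' => //; first by lia.
      by move=> r rb; rewrite ur ?ts //; lia.
    move=> v vE i; rewrite ltnS leq_eqVlt => /orP[/eqP ij|ij].
      have -> : i = ii by apply: val_inj; rewrite /= iiE.
      by apply: ug; rewrite vE; apply/esym/(map_agree argsb).
    by rewrite ur; [exact: gt | rewrite iiE; lia].
  by apply: (key 0 s) => //; rewrite drop0.
- move=> [t1 st1 [t2 t12 [t3 t23 [t4 [m t34] [/= /eqP okt ->]]]]].
  have bargs : all (fun x => x < b) (behead args).
    by apply/allP => x /mem_behead /(allP argsb).
  have [|||ft1 rt1] := IHf _ _ _ _ _ _ _ st1 => //.
    by apply: allW bargs _; lia.
  have [|t2b t2r] := exec_Copy _ t12; first by lia.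
  case: t23 => _ /= t3E.
  pose G (v : n.+1.-tuple nat) m z := murec_eval g [tuple of m :: z :: behead v].
  (* Loop invariant: register [b.+1] counts the rounds and [b] holds the value of the recursion
     after that many. The final test forces the count to be the recursion argument. *)
  have inv : t4 b.+1 = m /\ (forall r, r < b -> t4 r = s r) /\
     (forall v : n.+1.-tuple nat, tval v = map s args ->
        prec_eval (murec_eval f [tuple of behead v]) (G v) m (t4 b)).
    elim: m t4 t34 {okt} => [|m IHm] t4 /=.
      move=> ->; rewrite t3E; split; first by rewrite /upd eqxx.
      split=> [r rb|v vE].
        by rewrite /upd ltn_eqF ?t2r ?rt1; lia.
      have -> : upd t2 b.+1 0 b = t1 b.+2 by rewrite updE ltn_eqF.
      apply: ft1.
      by rewrite /= vE behead_map.
    move=> [t5 /IHm[t5b [t5r t5p]] [t6 t56 [t7 t67 t74]]].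
    have [|||ft6 rt6] := IHg _ _ _ _ _ _ _ t56; first by rewrite t5r.
    - by [].
    - by rewrite /= !ltnS leqnn leqnSn /=; apply: allW bargs _; lia.
    have [|t7b t7r] := exec_Copy _ t67; first by lia.
    have [|t4b t4r] := exec_Inc _ t74.
      by rewrite t7r ?rt6 ?t5r //; lia.
    split; first by rewrite t4b t7r ?rt6 ?t5b //; lia.
    split=> [r rb|v vE].
      by rewrite t4r ?t7r ?rt6 ?t5r //; lia.
    exists (t5 b); first exact: t5p.
    rewrite t4r ?t7b; last by lia.
    apply: ft6; rewrite /= t5b vE -behead_map.
    by congr [:: _, _ & behead _]; apply/esym/(map_agree argsb).
  case: inv => t4b [t4r t4p]; split=> [v vE|r rb]; last by rewrite t4r.
  suff vm : thead v = m by move: (t4p v vE); rewrite -vm.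
  rewrite -t4b okt; have := size_tuple v; rewrite /thead (tnth_nth 0) vE.
  case: (args) argsb => //= a l /andP[ab _] _.
  by rewrite t4r.
- move=> [t1 [_ t1E] [t2 [m t12] [t3 t23 [t4 [_ t4E] [/= /eqP okt ->]]]]].
  have inv : t2 b = m /\ (forall r, r < b -> t2 r = s r) /\
     (forall v : n.-tuple nat, tval v = map s args ->
        forall i, i < m -> exists z, murec_eval f [tuple of i :: v] z.+1).
    elim: m t2 t12 {t23} => [|m IHm] t2 /=.
      move=> ->; rewrite t1E /= /upd eqxx; split=> //.
      by split=> // r rb; rewrite ltn_eqF.
    move=> [t5 /IHm[t5b [t5r t5p]] [t6 t56 [t7 [_ t7E]
      [t8 t78 [t9 [p t89] [t10 [/= /eqP ok10 t10E] t102]]]]]].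
    have [|||ft6 rt6] := IHf _ _ _ _ _ _ _ t56; first by rewrite t5r.
    - by [].
    - by rewrite /= !ltnS leqnn /=; apply: allW argsb _; lia.
    rewrite /= in t7E.
    have t70 : t7 0 = 1 by rewrite t7E updE rt6 ?t5r //; lia.
    have [|t8b t8r] := exec_Inc _ t78 => //.
    (* The guessed number starts at 1, so passing the test against it certifies that the value of
       [f] is positive. *)
    have [t9b t9r] : t9 b.+2 > 0 /\ forall r, r < b.+2 -> t9 r = t8 r.
      elim: p t9 t89 {ok10 t10E} => [|p IHp] t9 /=; first by move=> ->; rewrite t8b.
      move=> [u /IHp[ub ur] /exec_Inc]; rewrite ur ?t8r ?t70 //; try lia.
      case=> // -> t9r; split=> // r rb; rewrite t9r ?ur //; lia.
    have [|t2b t2r] := exec_Inc _ t102.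
      by rewrite t10E t9r ?t8r //; lia.
    have lt6 r : r < b.+2 -> t9 r = t6 r.
      by move=> rb; rewrite t9r // t8r ?t7E ?updE; try case: eqP; lia.
    split; first by rewrite t2b t10E lt6 ?rt6 ?t5b //; lia.
    split=> [r rb|v vE i].
      by rewrite t2r ?t10E ?lt6 ?rt6 ?t5r //; lia.
    rewrite ltnS leq_eqVlt => /orP[/eqP ->|]; last exact: t5p.
    exists (t6 b.+1).-1; rewrite prednK; last by rewrite -lt6 // -ok10.
    apply: ft6; rewrite /= t5b vE.
    by congr (_ :: _); apply/esym/(map_agree argsb).
  case: inv => t2b [t2r t2p].
  have [|||ft3 rt3] := IHf _ _ _ _ _ _ _ t23; first by rewrite t2r.
  - by [].
  - by rewrite /= !ltnS leqnn /=; apply: allW argsb _; lia.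
  have t4r r : r < b.+2 -> t4 r = t3 r by move=> rb; rewrite t4E /= updE; case: eqP => //; lia.
  split=> [v vE|r rb]; last by rewrite t4r ?rt3 ?t2r //; lia.
  have -> : t4 b = m by rewrite t4r ?rt3 ?t2b //; lia.
  split; last exact: t2p.
  have -> : 0 = t3 b.+1 by rewrite -t4r // okt t4E /= updE eqxx.
  apply: ft3; rewrite /= t2b vE.
  by congr (_ :: _); apply/esym/(map_agree argsb).
Qed.
Lemma compile_spec n (f : murec n) args b s s' v y :
  s 0 = 1 -> 0 < b -> all (fun x => x < b) args -> tval v = map s args ->
  murec_eval f v y -> exec (compile f args b) s s' ->
  s' b = y /\ forall r, r < b -> s' r = s r.
Proof.
move=> s0 b0 argsb vE fy ex; have [ev ag] := compile_sound s0 b0 argsb ex.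
by split=> //; apply: murec_eval_fun (ev v vE) fy.
Qed.

Lemma compile_complete n (f : murec n) args b s v y :
  s 0 = 1 -> 0 < b -> all (fun x => x < b) args -> tval v = map s args ->
  murec_eval f v y -> exists s', exec (compile f args b) s s'.
Proof.
have allW c c' l : all (fun x => x < c) l -> c <= c' -> all (fun x => x < c') l.
  by move=> lc cc; apply: sub_all lc => x /leq_trans; apply.
elim: n / f args b s v y => [n||n i|k n f IHf g IHg|n f IHf g IHg|n f IHf] args b s v y s0 b0 argsb vE.
- by move=> _; eexists.
- move=> _; have [t st] := exec_Copy_ex b (head 0 args) s.
  by exists (op_upd (Add b 0) t), t.
- by move=> _; apply: exec_Copy_ex.
- move=> [w [gw fw]].
  pose D := foldr (fun i c => compile (g i) args (b.+1 + i) ;; c)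
            (compile f (iota b.+1 k) (b.+1 + k) ;; Copy b (b.+1 + k)).
  have key j t : j <= k -> (forall r, r < b -> t r = s r) ->
      (forall i : 'I_k, i < j -> t (b.+1 + i) = tnth w i) ->
      exists s', exec (D (drop j (enum 'I_k))) t s'.
    move: {2}(k - j) (leqnn (k - j)) => m; elim: m j t => [|m IHm] j t km jk ts gt.
      have jkE : j = k by lia.
      rewrite jkE drop_oversize ?size_enum_ord //=.
      have [|||||u tu] := IHf (iota b.+1 k) (b.+1 + k) t w y; rewrite ?ts //.
      - by apply/allP => x; rewrite mem_iota; lia.
      - have -> : iota b.+1 k = [seq b.+1 + i | i <- iota 0 k] by rewrite -iotaDl addn0.
        have -> : [seq t i | i <- [seq b.+1 + i | i <- iota 0 k]] =
            [seq t (b.+1 + nat_of_ord i) | i <- enum 'I_k].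
          by rewrite -val_enum_ord -map_comp -map_comp; apply: eq_map.
        transitivity (tval [tuple tnth w i | i < k]).
          by congr tval; apply/eq_from_tnth => i; rewrite tnth_mktuple.
        by apply: eq_map => i /=; rewrite gt //; have := ltn_ord i; lia.
      by have [s' us'] := exec_Copy_ex b (b.+1 + k) u; exists s', u.
    case: (ltnP j k) => jk'; last by apply: (IHm j) => //; lia.
    rewrite (drop_nth (Ordinal jk')) ?size_enum_ord //=.
    set ii := nth _ _ _; have iiE : ii = j :> nat by rewrite nth_enum_ord.
    have tE : tval v = map t args by rewrite vE; apply/esym/(map_agree argsb).
    have t0 : t 0 = 1 by rewrite ts.
    have argsb' : all (fun x => x < b.+1 + ii) args by apply: allW argsb _; lia.
    have [|u tu] := IHg ii args (b.+1 + ii) t v (tnth w ii) t0 _ argsb' tE (gw ii) => //.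
    have [|ub ur] := compile_spec t0 _ argsb' tE (gw ii) tu => //.
    have [||||s' us'] := IHm j.+1 u; first by lia.
    - by [].
    - by move=> r rb; rewrite ur ?ts //; lia.
    - move=> i; rewrite ltnS leq_eqVlt => /orP[/eqP ij|ij].
        by have -> : i = ii by apply: val_inj; rewrite /= iiE.
      by rewrite ur; [exact: gt | rewrite iiE; lia].
    by exists s', u.
  by have := key 0 s; rewrite drop0; apply.
- have bargs : all (fun x => x < b) (behead args).
    by apply/allP => x /mem_behead /(allP argsb).
  pose F := murec_eval f [tuple of behead v].
  pose G m z := murec_eval g [tuple of m :: z :: behead v].
  have vbE : tval [tuple of behead v] = map s (behead args) by rewrite /= vE behead_map.
  rewrite murec_eval_precE -/F -/G => Py.
  have [y0 F0] : exists y0, F y0.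
    elim: (thead v) y Py => [|m IHm] y /=; first by exists y.
    by case=> z /IHm.
  have bargs2 : all (fun x => x < b.+2) (behead args) by apply: allW bargs _; lia.
  have [//|t1 st1] := IHf _ b.+2 s _ y0 s0 _ bargs2 vbE F0.
  have [//|t1b t1r] := compile_spec s0 _ bargs2 vbE F0 st1.
  have [t2 t12] := exec_Copy_ex b b.+2 t1.
  have [|t2b t2r] := exec_Copy _ t12; first by lia.
  have [t4 [ex4 t4b' t4b t4r]] : exists t4, [/\
      iter_rel (exec (compile g [:: b.+1, b & behead args] b.+2 ;;
        Copy b b.+2 ;; Inc b.+1)) (thead v) (upd t2 b.+1 0) t4,
      t4 b.+1 = thead v, t4 b = y & forall r, r < b -> t4 r = s r].
    elim: (thead v) y Py => [|m IHm] y Py.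
      exists (upd t2 b.+1 0); split; rewrite ?updE ?eqxx //.
        rewrite ltn_eqF // t2b t1b; exact: murec_eval_fun F0 Py.
      by move=> r rb; rewrite updE ltn_eqF ?t2r ?t1r //; lia.
    case: Py => z /IHm[t4 [ex4 t4b' t4b t4r]] Gy.
    have t40 : t4 0 = 1 by rewrite t4r.
    have gargs : all (fun x => x < b.+2) [:: b.+1, b & behead args].
      by rewrite /= !ltnS leqnn leqnSn.
    have gE : tval [tuple of m :: z :: behead v] = map t4 [:: b.+1, b & behead args].
      rewrite /= t4b t4b'; congr [:: _, _ & _].
      by rewrite vE -behead_map; congr behead; apply/esym/(map_agree argsb).
    have [//|t5 t45] := IHg _ b.+2 t4 _ y t40 _ gargs gE Gy.
    have [//|t5b t5r] := compile_spec t40 _ gargs gE Gy t45.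
    have [t6 t56] := exec_Copy_ex b b.+2 t5.
    have [|t6b t6r] := exec_Copy _ t56; first by lia.
    have t67 : exec (Inc b.+1) t6 (op_upd (Add b.+1 0) t6) by [].
    have [|t7b t7r] := exec_Inc _ t67; first by rewrite t6r ?t5r //; lia.
    exists (op_upd (Add b.+1 0) t6); split.
    - by exists t4 => //; exists t5 => //; exists t6.
    - by rewrite t7b t6r ?t5r ?t4b' //; lia.
    - by rewrite t7r ?t6b ?t5b //; lia.
    - by move=> r rb; rewrite t7r ?t6r ?t5r ?t4r //; lia.
  exists t4; exists t1 => //; exists t2 => //; exists (upd t2 b.+1 0) => //.
  exists t4; first by exists (thead v).
  split=> //=; rewrite t4b' /thead (tnth_nth 0) vE; apply/eqP.
  have := size_tuple v; rewrite vE; case: (args) argsb => //= a l /andP[ab _] _.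
  by rewrite t4r.
- move=> [ev0 lt].
  have argsb1 : all (fun x => x < b.+1) (b :: args).
    by rewrite /= ltnS leqnn /=; apply: allW argsb _; lia.
  have [t2 [ex2 t2b t2r]] : exists t2, [/\ iter_rel (exec (compile f (b :: args) b.+1 ;;
            Op (Zero b.+2) ;; Inc b.+2 ;; Star (Inc b.+2) ;;
            Op (Test b.+2 b.+1) ;; Inc b)) y (upd s b 0) t2, t2 b = y & forall r, r < b -> t2 r = s r].
    move: y lt {ev0}; elim=> [|m IHm] lt.
      exists (upd s b 0); split; rewrite ?updE ?eqxx //.
      by move=> r rb; rewrite updE ltn_eqF.
    have [i im|t2 [ex2 t2b t2r]] := IHm; first by apply: lt; lia.
    have [//|z fz] := lt m.
    have t20 : t2 0 = 1 by rewrite t2r.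
    have gE : tval [tuple of m :: v] = map t2 (b :: args).
      by rewrite /= t2b vE; congr (_ :: _); apply/esym/(map_agree argsb).
    have [//|t3 t23] := IHf _ b.+1 t2 _ _ t20 _ argsb1 gE fz.
    have [//|t3b t3r] := compile_spec t20 _ argsb1 gE fz t23.
    pose t4 := upd t3 b.+2 0.
    have t40 : t4 0 = 1 by rewrite /t4 updE t3r //; lia.
    have [t5 [ex5 t5b t5r]] : exists t5, [/\
        iter_rel (exec (Inc b.+2)) z (op_upd (Add b.+2 0) t4) t5,
        t5 b.+2 = z.+1 & forall r, r < b.+2 -> t5 r = t3 r].
      elim: z {fz t3b} => [|z [t5 [ex5 t5b t5r]]].
        exists (op_upd (Add b.+2 0) t4); split=> //=.
          by rewrite updE eqxx t40 /t4 updE eqxx.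
        by move=> r rb; rewrite updE ltn_eqF // /t4 updE ltn_eqF.
      exists (op_upd (Add b.+2 0) t5); split=> [|/=|r rb /=].
      - by exists t5.
      - by rewrite updE eqxx t5b t5r // t3r ?t20 ?addn1 //; lia.
      - by rewrite updE ltn_eqF // t5r.
    exists (op_upd (Add b 0) t5); split=> [|/=|r rb /=].
    - exists t2 => //; exists t3 => //; exists t4 => //; exists (op_upd (Add b.+2 0) t4) => //.
      exists t5; first by exists z.
      exists t5 => //; split=> //=; apply/eqP; rewrite t5b t5r // t3b //.
    - by rewrite updE eqxx !t5r ?t3r ?t20 ?t2b ?addn1 //; lia.
    - by rewrite updE ltn_eqF ?t5r ?t3r ?t2r //; lia.
  have t20 : t2 0 = 1 by rewrite t2r.
  have gE : tval [tuple of y :: v] = map t2 (b :: args).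
    by rewrite /= t2b vE; congr (_ :: _); apply/esym/(map_agree argsb).
  have [//|t3 t23] := IHf _ b.+1 t2 _ _ t20 _ argsb1 gE ev0.
  have [//|t3b t3r] := compile_spec t20 _ argsb1 gE ev0 t23.
  exists (upd t3 b.+2 0); exists (upd s b 0) => //; exists t2; first by exists y.
  exists t3 => //; exists (upd t3 b.+2 0) => //; split=> //=.
  by rewrite /upd eqxx (_ : (b.+1 == b.+2) = false) ?t3b //; lia.
Qed.

Lemma iter_rel_cons (r : store -> store -> Prop) k s t s' :
  r s t -> iter_rel r k t s' -> iter_rel r k.+1 s s'.
Proof.
move=> st; elim: k s' => [|k IHk] s' /=; first by move=> ->; exists s.
by case=> u /IHk su us'; exists u.
Qed.

(** * Flow graphs *)

Inductive instr := IOp of op | IBr of nat & nat.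

Definition jump (a : instr) (b : bool) (i : nat) : nat :=
  match a with IOp _ => i.+1 | IBr j k => if b then j else k end.

(** A branch counts as the always successful test [Test 0 0], so that every instruction has an
    operation; the letter read only chooses the target. *)
Definition iop (a : instr) : op := if a is IOp o then o else Test 0 0.

(** Targets are absolute, whence [base]. A star becomes a branch that enters or skips the body, and
    the body ends with a jump back to that branch. *)
Fixpoint flat (c : com) (base : nat) : seq instr :=
  match c with
  | Op o => [:: IOp o]
  | Seq c1 c2 => flat c1 base ++ flat c2 (base + size (flat c1 base))
  | Star c1 => let p := flat c1 base.+1 in
      IBr base.+1 (base + size p).+2 :: rcons p (IBr base base)
  end.

Definition iget (p : seq instr) i := nth (IBr 0 0) p i.

Fixpoint run (p : seq instr) (w : seq bool) i s j s' : Prop :=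
  if w is b :: w' then
    [/\ i < size p, op_ok (iop (iget p i)) s &
        run p w' (jump (iget p i) b i) (op_upd (iop (iget p i)) s) j s']
  else i = j /\ s = s'.

Lemma run_cat p w w' i s j t k u :
  run p w i s j t -> run p w' j t k u -> run p (w ++ w') i s k u.
Proof.
elim: w i s => [|b w IHw] i s /=; first by case=> -> ->.
by case=> ip ok /IHw r /r.
Qed.

Definition embed (p : seq instr) base code :=
  base + size code <= size p /\
  forall i, i < size code -> iget p (base + i) = iget code i.

Lemma embed_cat p base c1 c2 : embed p base (c1 ++ c2) ->
  embed p base c1 /\ embed p (base + size c1) c2.
Proof.
rewrite /embed size_cat => -[le nthE]; split; split; try lia.
  by move=> i ic; rewrite nthE /iget ?nth_cat ?ic //; lia.
move=> i ic; rewrite -addnA nthE /iget ?nth_cat; last by lia.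
by case: ltnP; rewrite ?addKn //; lia.
Qed.

Lemma embed_star p base c : embed p base (flat (Star c) base) ->
  let e := base.+1 + size (flat c base.+1) in
  [/\ embed p base.+1 (flat c base.+1), e < size p,
      iget p base = IBr base.+1 e.+1 & iget p e = IBr base base].
Proof.
rewrite /= -cat1s -cats1 => /embed_cat[[_ h]] /embed_cat[].
rewrite /= !addn1 => e1 [e2 h2].
split=> //; first by rewrite /= in e2; lia.
  by have /= := h 0 isT; rewrite addn0.
by have /= := h2 0 isT; rewrite addn0.
Qed.

Lemma flat_complete c p base s s' : embed p base (flat c base) -> exec c s s' ->
  exists w, run p w base s (base + size (flat c base)) s'.
Proof.
elim: c p base s s' => [o|c1 IH1 c2 IH2|c IHc] p base s s'.
- move=> [le /(_ 0 isT)]; rewrite /= addn0 => pE [ok ->].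
  by exists [:: true]; rewrite /= pE /= addn1; split=> //=; rewrite /= in le; lia.
- move=> /embed_cat[e1 e2] [t /(IH1 _ _ _ _ e1)[w1 r1] /(IH2 _ _ _ _ e2)[w2 r2]].
  by exists (w1 ++ w2); rewrite /= size_cat addnA; apply: run_cat r1 r2.
- move=> /[dup] -[le _] /embed_star /=; set e := _ + _ => -[ec ep p0 pe] [k ex].
  have be : base < e by rewrite /e; lia.
  have -> : base + (size (rcons (flat c base.+1) (IBr base base))).+1 = e.+1.
    by rewrite size_rcons /e; lia.
  suff [w rw] : exists w, run p w base s base s'.
    exists (w ++ [:: false]); apply: run_cat rw _.
    by rewrite /= p0 /=; split=> //; lia.
  elim: k s' ex => [|k IHk] s' /=; first by move=> ->; exists [::].
  case=> t /IHk[w rw] /(IHc _ _ _ _ ec)[w' rw'].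
  exists (w ++ true :: w' ++ [:: true]); apply: run_cat rw _.
  rewrite /= p0 /=; split=> //; first by lia.
  apply: run_cat rw' _; rewrite /= -/e pe /=; split=> //.
Qed.

(** Control leaves a block only at its end, so a run that gets that far splits there. The bound on
    the length of the remaining word drives the induction for stars. *)
Lemma flat_sound c p base w s j s' : embed p base (flat c base) ->
  base + size (flat c base) <= j -> run p w base s j s' ->
  exists w' t, [/\ exec c s t, size w' <= size w &
    run p w' (base + size (flat c base)) t j s'].
Proof.
elim: c p base w s j s' => [o|c1 IH1 c2 IH2|c IHc] p base w s j s'.
- move=> [le /(_ 0 isT)]; rewrite /= addn0 => pE jb.
  case: w => [|b w] /=; first by lia.
  rewrite pE addn1 /= => -[_ ok r].
  by exists w, (op_upd o s).
- move=> /embed_cat[e1 e2] /=; rewrite size_cat addnA => le r.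
  have [|w1 [t [ex1 sz1 r1]]] := IH1 _ _ _ _ _ _ e1 _ r; first by lia.
  have [|w2 [u [ex2 sz2 r2]]] := IH2 _ _ _ _ _ _ e2 _ r1; first exact: le.
  by exists w2, u; split=> //; [exists t | lia].
- move=> /embed_star /=; set e := _ + _ => -[ec ep p0 pe].
  have be : base < e by rewrite /e; lia.
  have -> : base + (size (rcons (flat c base.+1) (IBr base base))).+1 = e.+1.
    by rewrite size_rcons /e; lia.
  move=> ej; move: {2}(size w) (leqnn (size w)) => n.
  elim: n w s => [|n IHn] [|b w] s //=; try by lia.
  move=> wn; rewrite p0 /=; case: b => -[_ _ r]; last first.
    by exists w, s; split=> //; exists 0.
  have [|[|b w1] [t [ex1 sz1]]] := IHc _ _ _ _ _ _ ec _ r; rewrite /= -/e; try lia.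
  rewrite pe /= => -[_ _]; rewrite if_same => r1.
  have [|w2 [u [[k exk] sz2 r2]]] := IHn w1 t _ r1; first by move: sz1 => /=; lia.
  exists w2, u; split=> //; last by move: sz1 => /=; lia.
  by exists k.+1; apply: iter_rel_cons exk.
Qed.

Lemma flat_exec c s0 :
  let p := flat c 0 in
  (exists s', exec c s0 s') <-> exists w s', run p w 0 s0 (size p) s'.
Proof.
have e0 : embed (flat c 0) 0 (flat c 0) by split.
split=> [[s' /(flat_complete e0)[w r]]|[w [s' r]]]; first by exists w, s'.
have [|w' [t [ex _ _]]] := flat_sound e0 _ r => //.
by exists t.
Qed.

(* The squared error (s x - s y)^2 of a test is kept as a difference of two
   naturals, so that nonnegative matrices can accumulate both parts. *)
Definition epos (o : op) (s : store) :=
  if o is Test x y then s x ^ 2 + s y ^ 2 else 0.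
Definition eneg (o : op) (s : store) :=
  if o is Test x y then 2 * (s x * s y) else 0.

(** These runs go on after failed tests; [P] and [M] add up the positive and negative parts of the
    squared errors. *)
Inductive reach (p : seq instr) (s0 : store) : nat -> store -> nat -> nat -> Prop :=
| reach0 : reach p s0 0 s0 0 0
| reachS b i s P M : reach p s0 i s P M -> i < size p ->
    reach p s0 (jump (iget p i) b i) (op_upd (iop (iget p i)) s)
      (P + epos (iop (iget p i)) s) (M + eneg (iop (iget p i)) s).

(** For a test this is [2xy <= x^2 + y^2], with equality only if [x = y]. *)
Lemma err_ok o s : eneg o s <= epos o s /\ (op_ok o s <-> eneg o s = epos o s).
Proof.
case: o => [x|x y|x y] //=; have [le eq] := nat_Cauchy (s x) (s y).
by split=> //; rewrite -eq; split=> /eqP.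
Qed.

(** The error of each step is nonnegative, so a total of 0 forces every test on the way to
    succeed. *)
Lemma reach_run p s0 i s P M : reach p s0 i s P M ->
  M <= P /\ (M = P -> exists w, run p w 0 s0 i s).
Proof.
elim=> [|b i' s' P' M' _ [le run'] ip]; first by split=> // _; exists [::].
have [le' ok'] := err_ok (iop (iget p i')) s'; split; first by lia.
move=> eq; have [|w rw] := run'; first by lia.
exists (w ++ [:: b]); apply: run_cat rw _; split=> //=.
by apply/ok'; lia.
Qed.

Definition op_bound N (o : op) :=
  match o with Zero x => x < N | Add x y | Test x y => (x < N) && (y < N) end.

Lemma op_boundW N N' o : N <= N' -> op_bound N o -> op_bound N' o.
Proof. by case: o => [x|x y|x y] /=; lia. Qed.

Lemma bound_exists p : exists2 N, 1 < N & all (fun a => op_bound N (iop a)) p.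
Proof.
elim: p => [|a p [N N1 pN]]; first by exists 2.
have [N' aN'] : exists N', op_bound N' (iop a).
  case: (iop a) => [x|x y|x y].
  - by exists x.+1 => /=.
  - by exists (x + y).+1 => /=; lia.
  - by exists (x + y).+1 => /=; lia.
exists (N + N'); first by lia.
rewrite /= (op_boundW _ aN') ?leq_addl //=.
by apply: sub_all pN => o; apply: op_boundW; rewrite leq_addr.
Qed.

(** * The matrices of a program *)

Lemma big_unit R (idx : R) (op : Monoid.com_law idx) (F : unit -> R) :
  \big[op/idx]_(i : unit) F i = F tt.
Proof. by rewrite (bigD1 tt) //= big1 ?Monoid.mulm1 // => -[]. Qed.

(* Coordinates at a program location: products of two registers, the positive
   ([true]) and negative ([false]) part of the accumulated test errors, and a
   slack coordinate making all rows sum to 1. *)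
Definition coords N := (('I_N * 'I_N + bool) + unit)%type.

Definition upd_mx N (o : op) (k j : 'I_N) : nat :=
  match o with
  | Zero x => (k == j) && (j != x :> nat)
  | Add x y => (k == j) + ((k == y :> nat) && (j == x :> nat))
  | Test _ _ => k == j
  end.

Lemma upd_mxP N o (s : store) (j : 'I_N) : op_bound N o ->
  \sum_(k < N) s k * upd_mx o k j = op_upd o s j.
Proof.
have del (g : 'I_N -> nat) : \sum_k g k * (k == j) = g j.
  rewrite (bigD1 j) //= eqxx muln1 big1 ?addn0 // => i /negbTE ->.
  by rewrite muln0.
case: o => [x|x y|x y] /= b; last exact: del.
  rewrite updE; under eq_bigr do rewrite -mulnb.
  case: eqP => _ /=; first by rewrite big1 // => i; rewrite muln0 muln0.
  by under eq_bigr do rewrite muln1; exact: del.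
have [bx /[dup] bY] := andP b; rewrite updE.
under eq_bigr do rewrite mulnDr.
rewrite big_split /= del => _; case: eqP => jx; last first.
  by rewrite big1 ?addn0 // => i _; rewrite andbF muln0.
rewrite -jx (bigD1 (Ordinal bY)) //= eqxx muln1 big1 ?addn0 // => i iy.
suff -> : (i == y :> nat) = false by rewrite muln0.
by apply: contraNF iy => /eqP iy; apply/eqP/val_inj.
Qed.

(** The tensor square of [upd_mx] acts on products of registers. A test also feeds [x^2 + y^2] and
    [2xy] into the two error coordinates, which otherwise persist. *)
Definition wt N (o : op) (a b : coords N) : nat :=
  match a, b with
  | inl (inl (j, k)), inl (inl (j', k')) => upd_mx o j j' * upd_mx o k k'
  | inl (inl (j, k)), inl (inr true) =>
      if o is Test x y then ((j == x :> nat) && (k == x :> nat)) +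
                            ((j == y :> nat) && (k == y :> nat)) else 0
  | inl (inl (j, k)), inl (inr false) =>
      if o is Test x y then 2 * ((j == x :> nat) && (k == y :> nat)) else 0
  | inl (inr e), inl (inr e') => e == e'
  | _, _ => 0
  end.

Lemma wt_step N o (s : store) P M (b : 'I_N * 'I_N + bool) : op_bound N o ->
  \sum_(j < N) \sum_(k < N) s j * s k * wt o (inl (inl (j, k))) (inl b) +
    (P * wt o (inl (inr true) : coords N) (inl b) +
     M * wt o (inl (inr false) : coords N) (inl b)) =
  match b with
  | inl (j, k) => op_upd o s j * op_upd o s k
  | inr e => if e then P + epos o s else M + eneg o s
  end.
Proof.
have del x (xN : x < N) (f : nat -> nat) : \sum_(i < N) (i == x :> nat) * f i = f x.
  rewrite (bigD1 (Ordinal xN)) //= eqxx mul1n big1 ?addn0 // => i /negbTE.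
  by rewrite -val_eqE /= => ->.
have del2 x y (xN : x < N) (yN : y < N) c : \sum_(j < N) \sum_(k < N) s j * s k *
    (c * ((j == x :> nat) && (k == y :> nat))) = c * (s x * s y).
  transitivity (\sum_(j < N) (j == x :> nat) * (\sum_(k < N) (k == y :> nat) * (c * (s j * s k)))).
    apply: eq_bigr => j _; rewrite big_distrr; apply: eq_bigr => k _.
    by rewrite -mulnb /=; lia.
  rewrite (del x xN (fun j => \sum_(k < N) (k == y :> nat) * (c * (s j * s k)))).
  exact: (del y yN (fun k => c * (s x * s k))).
case: b => [[j' k']|e] ob.
  rewrite /= !muln0 !addn0 -!upd_mxP // big_distrl /=; apply: eq_bigr => j _.
  by rewrite big_distrr /=; apply: eq_bigr => k _; rewrite mulnACA.
rewrite addnC; case: o ob => [x|x y|x y] ob; case: e => /=;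
  rewrite ?muln0 ?muln1 ?addn0 ?add0n;
  try (by rewrite big1 ?addn0 // => j _; rewrite big1 // => k _; rewrite muln0);
  congr (_ + _).
  move/andP: ob => [xN yN].
  under eq_bigr do under eq_bigr do rewrite mulnDr -[X in _ * X + _]mul1n -[X in _ + _ * X]mul1n.
  under eq_bigr do rewrite big_split /=.
  by rewrite big_split /= !del2 // !mul1n !mulnn.
by move/andP: ob => [xN yN]; rewrite del2.
Qed.

Definition rowsum N o (a : coords N) := \sum_b wt o a b.

Local Open Scope ring_scope.

(** Division by a bound [B] on the row sums makes the rows substochastic, and the slack column
    collects the missing mass. The slack row has weight 0, so slack stays slack. *)
Definition stoch N (B : nat) (o : op) (a b : coords N) : rat :=
  if b is inr _ then 1 - (rowsum o a)%:R / B%:R else (wt o a b)%:R / B%:R.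

Lemma sum_coords N (f : coords N -> rat) :
  \sum_a f a = \sum_j \sum_k f (inl (inl (j, k))) +
    (f (inl (inr true)) + f (inl (inr false))) + f (inr tt).
Proof.
rewrite big_sumType /= big_sumType /= big_bool big_unit; congr (_ + _ + _).
by rewrite pair_bigA /=; apply: eq_bigr => -[].
Qed.

Lemma stoch_row N B o (a : coords N) : \sum_b stoch B o a b = 1.
Proof.
rewrite big_sumType /= big_unit /= -mulr_suml.
have -> : \sum_(i : 'I_N * 'I_N + bool) (wt o a (inl i))%:R = (rowsum o a)%:R :> rat.
  rewrite -natr_sum /rowsum [in RHS]big_sumType /= big_unit.
  by case: a => [[[]|]|] *; rewrite addn0.
by rewrite addrC subrK.
Qed.

Lemma stoch_ge0 N B o (a b : coords N) : (rowsum o a <= B)%N -> 0 <= stoch B o a b.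
Proof.
case: b => [b|b] le /=; first by rewrite divr_ge0 ?ler0n.
rewrite subr_ge0; have [->|B0] := eqVneq B 0%N; first by rewrite invr0 mulr0.
by rewrite ler_pdivrMr ?mul1r ?ler_nat // ltr0n lt0n.
Qed.

(* The coordinates of the store [s] with error [P - M], scaled by [c]. *)
Definition vec N (s : store) (P M : nat) (c : rat) (a : coords N) : rat :=
  match a with
  | inl (inl (j, k)) => c * (s j * s k)%:R
  | inl (inr e) => c * (if e then P else M)%:R
  | inr _ => 1 - c * (\sum_(j < N) \sum_(k < N) (s j * s k)%:R + (P%:R + M%:R))
  end.

Lemma vec_sum N s P M c : \sum_a @vec N s P M c a = 1.
Proof.
rewrite sum_coords /=; under eq_bigr do rewrite -mulr_sumr.
by rewrite -mulr_sumr -!mulrDr addrC subrK.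
Qed.

(** Products of registers transform linearly under the tensor square, so runs are followed exactly,
    up to a scale that is divided by [B]. *)
Lemma vec_step N B o s P M c (b : coords N) : op_bound N o ->
  \sum_a vec s P M c a * stoch B o a b =
  vec (op_upd o s) (P + epos o s) (M + eneg o s) (c / B%:R) b.
Proof.
move=> ob.
have main (b' : 'I_N * 'I_N + bool) : \sum_a vec s P M c a * stoch B o a (inl b') =
  vec (op_upd o s) (P + epos o s) (M + eneg o s) (c / B%:R) (inl b').
  have vE : vec (op_upd o s) (P + epos o s) (M + eneg o s) (c / B%:R) (inl b' : coords N) =
      c / B%:R * (match b' with
        | inl (j, k) => op_upd o s j * op_upd o s k
        | inr e => if e then P + epos o s else M + eneg o s
        end)%N%:R by case: b' => [[]|].
  rewrite vE -(wt_step s P M b' ob) sum_coords /= mul0r mulr0 addr0.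
  rewrite !natrD !natrM [in RHS]mulrDr; congr (_ + _); last by ring.
  rewrite natr_sum mulr_sumr; apply: eq_bigr => j _.
  rewrite natr_sum mulr_sumr; apply: eq_bigr => k _.
  by rewrite !natrM; ring.
case: b => [b|[]]; first exact: main.
(* The slack coordinate follows from the others, as both sides have total mass 1. *)
have tot : \sum_(b : coords N) \sum_a vec s P M c a * stoch B o a b = 1.
  rewrite exchange_big /= -[RHS](@vec_sum N s P M c); apply: eq_bigr => a _.
  by rewrite -mulr_sumr stoch_row mulr1.
rewrite big_sumType /= big_unit /= in tot.
apply: (addrI (\sum_(i : 'I_N * 'I_N + bool) \sum_a vec s P M c a * stoch B o a (inl i))).
rewrite tot; under [in RHS]eq_bigr do rewrite main.
by have := @vec_sum N (op_upd o s) (P + epos o s) (M + eneg o s) (c / B%:R);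
  rewrite big_sumType /= big_unit /= => ->.
Qed.

Local Open Scope nat_scope.

(** Protects register 0, the constant 1. *)
Definition writes_pos (o : op) :=
  match o with Zero x | Add x _ => 0 < x | Test _ _ => true end.

Fixpoint com_writes_pos c : bool :=
  match c with
  | Op o => writes_pos o
  | Seq c1 c2 => com_writes_pos c1 && com_writes_pos c2
  | Star c1 => com_writes_pos c1
  end.

Lemma compile_writes_pos n (f : murec n) args b : 0 < b -> com_writes_pos (compile f args b).
Proof.
elim: n / f args b => [n||n i|k n f IHf g IHg|n f IHf g IHg|n f IHf] args b b0 //=.
- by rewrite !b0.
- by rewrite b0.
- elim: (enum _) => [|i l IHl] /=; first by rewrite IHf ?b0.
  by rewrite IHg.
- by rewrite IHf ?IHg ?b0.
- by rewrite IHf ?b0.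
Qed.

Lemma flat_writes_pos c base : com_writes_pos c ->
  all (fun a => writes_pos (iop a)) (flat c base).
Proof.
elim: c base => [o|c1 IH1 c2 IH2|c IHc] base /=.
- by rewrite andbT.
- by case/andP => /IH1 h1 /IH2 h2; rewrite all_cat h1 h2.
- by move=> /IHc h; rewrite all_rcons h.
Qed.

(** Guarantees that the locations up to the length of the program suffice as states, the last one
    being the halting location. *)
Lemma flat_jump c base b i : i < size (flat c base) ->
  jump (iget (flat c base) i) b (base + i) <= base + size (flat c base).
Proof.
elim: c base i => [o|c1 IH1 c2 IH2|c IHc] base i.
- by case: i => //= _; lia.
- rewrite /= size_cat /iget nth_cat => ic2; case: ltnP => ic.
    by have := IH1 base i ic; rewrite /iget; lia.
  have := IH2 (base + size (flat c1 base)) (i - size (flat c1 base)).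
  by rewrite -addnA subnKC // -!addnA; apply; lia.
- case: i => [|i] /=; first by case: (b) => _; rewrite size_rcons; lia.
  rewrite size_rcons ltnS /iget /= nth_rcons ltnS => isz.
  case: ltnP => [ic|ic].
    have := IHc base.+1 i ic; rewrite addSnnS /iget. lia.
  by case: eqP => _ /=; case: (b); lia.
Qed.

Definition store0 n : store := fun x => if x == 0 then 1 else if x == 1 then n else 0.

Local Open Scope ring_scope.

(** * The two transition matrices acting on row vectors *)

Section Machine.
Variables (p : seq instr) (N n : nat).

Definition state : Type := ('I_(size p).+1 * coords N + bool)%type.
HB.instance Definition _ := Finite.on state.

Definition scale : nat :=
  (\max_(i < size p) \max_(a : coords N) rowsum (iop (iget p i)) a).+1.

(* 1 + h, where h is the square of register 0, which holds 1, minus the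
   accumulated test error. *)
Definition final_weight (a : coords N) : rat :=
  match a with
  | inl (inl (j, k)) => 1 + ((j == 0%N :> nat) && (k == 0%N :> nat))%:R
  | inl (inr e) => if e then 0 else 2
  | inr _ => 1
  end.

(* The state [inr true] is the initial one, [inr false] an isolated fixed
   point, which makes 1 an eigenvalue of all products. *)
Definition trans (b : bool) (x y : state) : rat :=
  match x, y with
  | inl (i, a), inl (i', a') =>
      if (i < size p)%N then
        if i' == jump (iget p i) b i :> nat then stoch scale (iop (iget p i)) a a' else 0
      else 0
  | inl (i, a), inr t => if (i < size p)%N || ~~ t then 0 else final_weight a
  | inr true, inl (i', a') =>
      if b && (i' == 0%N :> nat) then vec (store0 n) 0 0 (n.+1 ^ 2)%:R^-1 a' else 0
  | inr t, inr t' => ((t == t') && (b ==> ~~ t))%:R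
  | inr false, inl _ => 0
  end.

Definition act (f : state -> rat) (b : bool) : state -> rat :=
  fun y => \sum_x f x * trans b x y.

Definition at_loc (i : nat) (xi : coords N -> rat) : state -> rat :=
  fun t => if t is inl (i', a) then if i' == i :> nat then xi a else 0 else 0.

Definition at_pt (t : bool) (c : rat) : state -> rat :=
  fun t' => if t' == inr t then c else 0.

Hypothesis N1 : (1 < N)%N.
Hypothesis pN : all (fun a => op_bound N (iop a)) p.
Hypothesis pw : all (fun a => writes_pos (iop a)) p.
Hypothesis pjump : forall i b, (i < size p)%N -> (jump (iget p i) b i <= size p)%N.

Lemma scale_ge i (a : coords N) : (i < size p)%N ->
  (rowsum (iop (iget p i)) a <= scale)%N.
Proof.
move=> ip; rewrite /scale leqW // (leq_trans _ (leq_bigmax (Ordinal ip))) //=.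
exact: (leq_bigmax (F := fun a => rowsum (iop (iget p i)) a)).
Qed.

(** The products of the initial registers sum to [(n + 1)^2], which the scale normalizes to 1. So
    the slack entry of the initial row is nonnegative and independent of [n]. *)
Lemma store0_slack u : vec (store0 n) 0 0 (n.+1 ^ 2)%:R^-1 (inr u : coords N) = 0.
Proof.
have sumE : (\sum_(j < N) store0 n j = n.+1)%N.
  rewrite (bigD1 (Ordinal (ltnW N1))) //= (bigD1 (Ordinal N1)) //= big1 ?addn0 //.
  by case=> [[|[|i]] ?] /=.
rewrite /= !mulr0n !addr0; under eq_bigr do rewrite -natr_sum -big_distrr /=.
rewrite -natr_sum -big_distrl /= sumE mulnn mulVf ?subrr //.
by rewrite pnatr_eq0 expn_eq0.
Qed.

Lemma trans_ge0 b x y : 0 <= trans b x y.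
Proof.
have vec0 (a : coords N) : 0 <= vec (store0 n) 0 0 (n.+1 ^ 2)%:R^-1 a :> rat.
  case: a => [[[j k]|e]|u] /=.
  - by rewrite mulr_ge0 ?invr_ge0 ?ler0n.
  - by rewrite if_same mulr0.
  - by have /= -> := store0_slack u.
case: x y => [[i a]|[]] [[i' a']|t] //=.
- by case: ltnP => // ip; case: ifP => // _; rewrite stoch_ge0 // scale_ge.
- case: ifP => // _; case: a => [[[j k]|[]]|[]] //=.
  by rewrite addr_ge0.
- by case: ifP.
Qed.

Lemma sum_at_loc i xi (g : state -> rat) : forall (ip : (i < (size p).+1)%N),
  \sum_x at_loc i xi x * g x = \sum_a xi a * g (inl (Ordinal ip, a)).
Proof.
move=> ip; rewrite big_sumType /= [X in _ + X]big1 ?addr0; last first.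
  by move=> *; rewrite mul0r.
transitivity (\sum_(i' < (size p).+1) \sum_a (if i' == i :> nat then xi a else 0) * g (inl (i', a))).
  by rewrite pair_bigA; apply: eq_bigr => -[].
rewrite (bigD1 (Ordinal ip)) //= [X in _ + X]big1 ?addr0; last first.
  move=> i' /negbTE; rewrite -val_eqE /= => ->.
  by rewrite big1 // => a _; rewrite mul0r.
by rewrite eqxx.
Qed.

Lemma sum_at_pt t c (g : state -> rat) : \sum_x at_pt t c x * g x = c * g (inr t).
Proof.
rewrite (bigD1 (inr t)) //= /at_pt eqxx big1 ?addr0 // => x /negbTE ->.
by rewrite mul0r.
Qed.

Lemma act_loc i xi b : (i < size p)%N ->
  act (at_loc i xi) b = at_loc (jump (iget p i) b i)
    (fun a' => \sum_a xi a * stoch scale (iop (iget p i)) a a').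
Proof.
move=> ip; apply/funext => y; rewrite /act (sum_at_loc _ _ (ltnW ip : i < (size p).+1)%N) /=.
rewrite ip; case: y => [[i' a']|t] /=; last by rewrite big1 // => a _; rewrite mulr0.
by case: eqP => // _; rewrite big1 // => a _; rewrite mulr0.
Qed.

Lemma act_final xi b :
  act (at_loc (size p) xi) b = at_pt true (\sum_a xi a * final_weight a).
Proof.
apply/funext => y; rewrite /act (sum_at_loc _ _ (ltnSn _)) /= ltnn /=.
case: y => [[i' a']|[]] /=; rewrite /at_pt /=.
- by rewrite big1 // => a _; rewrite mulr0.
- by [].
- by rewrite big1 // => a _; rewrite mulr0.
Qed.

Lemma act_start c : act (at_pt true c) true =
  at_loc 0 (fun a => c * vec (store0 n) 0 0 (n.+1 ^ 2)%:R^-1 a).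
Proof.
apply/funext => y; rewrite /act sum_at_pt.
by case: y => [[i' a']|[]] /=; rewrite ?mulr0 //; case: eqP; rewrite ?mulr0.
Qed.

Lemma act_stay c : act (at_pt true c) false = at_pt true c.
Proof.
apply/funext => y; rewrite /act sum_at_pt /at_pt.
by case: y => [[i' a']|[]] /=; rewrite ?mulr0 ?mulr1.
Qed.

Lemma act_fixpt b : act (at_pt false 1) b = at_pt false 1.
Proof.
apply/funext => y; rewrite /act sum_at_pt /at_pt.
by case: y => [[i' a']|[]] /=; rewrite ?mulr0 ?mulr1 ?implybT.
Qed.

Lemma vec_final s P M c : s 0%N = 1%N ->
  \sum_a vec s P M c a * final_weight a = 1 + c * (1 + M%:R - P%:R).
Proof.
move=> s0; have N0 := ltnW N1.
(* The summand 1 is written as the total mass, which the constant part of the weights reproduces;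
   what remains is the square of register 0 and the two error coordinates. *)
rewrite -[X in _ = X + _](@vec_sum N s P M c) [in RHS]sum_coords sum_coords /=.
under eq_bigr do under eq_bigr do rewrite mulrDr mulr1.
under eq_bigr do rewrite big_split /=.
rewrite big_split /= [X in _ + X + _ + _](_ : _ = c); first by rewrite mulr1; ring.
rewrite (bigD1 (Ordinal N0)) //= [X in _ + X]big1 ?addr0; last first.
  move=> j /negbTE; rewrite -val_eqE /= => ->.
  by rewrite big1 // => k _; rewrite mulr0.
rewrite (bigD1 (Ordinal N0)) //= big1 ?addr0; last first.
  move=> j /negbTE; rewrite -val_eqE /= => ->.
  by rewrite mulr0.
by rewrite s0 !mulr1.
Qed.

Lemma iget_bound i : (i < size p)%N -> op_bound N (iop (iget p i)).
Proof. exact: (elimT (all_nthP (IBr 0 0)) pN). Qed.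

Lemma act_vec i s P M c k b : (i < size p)%N ->
  act (at_loc i (fun a => c * vec s P M k a)) b =
  at_loc (jump (iget p i) b i) (fun a => c * vec (op_upd (iop (iget p i)) s)
    (P + epos (iop (iget p i)) s) (M + eneg (iop (iget p i)) s) (k / scale%:R) a).
Proof.
move=> ip; rewrite act_loc //; congr at_loc; apply/funext => a.
rewrite -vec_step; last exact: iget_bound.
by rewrite mulr_sumr; apply: eq_bigr => a' _; rewrite mulrA.
Qed.

Lemma reach_store0 i s P M : reach p (store0 n) i s P M -> s 0%N = 1%N /\ (i <= size p)%N.
Proof.
elim=> [|b i' s' P' M' _ [s0 _] ip] //; split; last exact: pjump.
have : writes_pos (iop (iget p i')) by exact: (elimT (all_nthP (IBr 0 0)) pw).
by case: (iop _) => [[|x]|[|x] y|x y].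
Qed.

Lemma act_vec_final s P M c k b : s 0%N = 1%N ->
  act (at_loc (size p) (fun a => c * vec s P M k a)) b =
  at_pt true (c * (1 + k * (1 + M%:R - P%:R))).
Proof.
move=> s0; rewrite act_final -(vec_final P M k s0) mulr_sumr.
by congr at_pt; apply: eq_bigr => a _; rewrite mulrA.
Qed.

Lemma scale_gt0 : 0 < scale%:R :> rat.
Proof. by rewrite ltr0n. Qed.

Lemma init_scale_gt0 : 0 < (n.+1 ^ 2)%:R^-1 :> rat.
Proof. by rewrite invr_gt0 ltr0n expn_gt0. Qed.

Lemma run_act w i s P k j s' :
  reach p (store0 n) i s P P -> 0 < k -> run p w i s j s' ->
  exists P' k', [/\ reach p (store0 n) j s' P' P', 0 < k' &
    foldl act (at_loc i (fun a => 1 * vec s P P k a)) w =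
    at_loc j (fun a => 1 * vec s' P' P' k' a)].
Proof.
elim: w i s P k => [|b w IHw] i s P k r k0 /=; first by case=> <- <-; exists P, k.
case=> ip ok rw; rewrite act_vec //.
have := reachS b r ip.
have [_ [/(_ ok) -> _]] := err_ok (iop (iget p i)) s => r'.
by apply: IHw => //; rewrite divr_gt0 ?scale_gt0.
Qed.

(** An error-free complete run returns to the initial state with mass [1 + k], where [k > 0] is the
    scale reached. *)
Lemma halting_word w s' : run p w 0 (store0 n) (size p) s' ->
  exists b w' c, 1 < c /\ foldl act (at_pt true 1) (b :: w') = at_pt true c.
Proof.
move=> rw; have [P [k [r k0 E]]] := run_act (reach0 _ _) init_scale_gt0 rw.
exists true, (w ++ [:: true]), (1 * (1 + k * (1 + P%:R - P%:R))); split.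
  by rewrite addrK mul1r mulr1 ltrDl.
by rewrite /= act_start foldl_cat E /= act_vec_final //; case: (reach_store0 r).
Qed.

(** Invariant of the rows of products when no run halts without error: a row lies at one location
    with arbitrary nonnegative coordinates of mass at most 1, or carries mass [c <= 2] at the
    initial state or along a run started there, or is the isolated fixed state. *)
Definition good (f : state -> rat) : Prop :=
  [\/ exists i xi, [/\ (i <= size p)%N, f = at_loc i xi,
        forall a, 0 <= xi a & \sum_a xi a <= 1],
      exists2 c, 0 <= c <= 2 & f = at_pt true c \/
        exists i s P M k, [/\ reach p (store0 n) i s P M, 0 < k,
          forall a : coords N, 0 <= vec s P M k a &
          f = at_loc i (fun a => c * vec s P M k a)]
    | f = at_pt false 1].

Lemma good_unit t : good (fun x => (t == x)%:R).
Proof.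
case: t => [[i a]|[]].
- apply: Or31; exists i, (fun x => (a == x)%:R); split=> //.
  + by rewrite -ltnS.
  + apply/funext => -[[i' a']|u] //=.
    rewrite (inj_eq inl_inj) xpair_eqE val_eqE eq_sym.
    by case: eqP.
  + by rewrite (bigD1 a) //= eqxx big1 ?addr0 // => x; rewrite eq_sym => /negbTE ->.
- apply: Or32; exists 1 => //; left; apply/funext => x.
  by rewrite /at_pt eq_sym; case: eqP.
- apply: Or33; apply/funext => x.
  by rewrite /at_pt eq_sym; case: eqP.
Qed.

Lemma good_bound f t : good f -> 0 <= f t <= 2.
Proof.
have le_sum (xi : coords N -> rat) a : (forall a, 0 <= xi a) -> xi a <= \sum_a xi a.
  by move=> xi0; rewrite (bigD1 a) //= lerDl sumr_ge0.
case=> [[i [xi [_ -> xi0 xi1]]]|[c /andP[c0 c2]]|->].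
- case: t => [[i' a]|u] //=; case: eqP => // _.
  by rewrite xi0 (le_trans (le_sum _ _ xi0)) // (le_trans xi1).
- case=> [->|[i [s [P [M [k [r k0 v0 ->]]]]]]]; first by rewrite /at_pt; case: eqP; rewrite ?c0.
  case: t => [[i' a]|u] //=; case: eqP => // _.
  rewrite mulr_ge0 //= (le_trans _ c2) // ler_piMr //.
  by rewrite (le_trans (le_sum _ _ v0)) // vec_sum.
- by rewrite /at_pt; case: eqP.
Qed.

Hypothesis nonhalting : forall s P M, reach p (store0 n) (size p) s P M -> (M < P)%N.

(** An arbitrary row can at most double its mass when it first leaves the halting location, as
    [final_weight] is at most 2. From then on it follows genuine runs, each of which multiplies it
    by a factor between 0 and 1. *)
Lemma good_act f b : good f -> good (act f b).
Proof.
have fw (a : coords N) : 0 <= final_weight a <= 2.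
  case: a => [[[j k]|[]]|u] //.
  by rewrite /= addr_ge0 ?ler0n //=; case: (_ && _).
case=> [[i [xi [ip -> xi0 xi1]]]|[c /andP[c0 c2]]|->].
- move: ip; rewrite leq_eqVlt => /orP[/eqP ->|ip].
    apply: Or32; eexists; last by left; exact: act_final.
    rewrite sumr_ge0 /=; last by move=> a _; rewrite mulr_ge0 //; case/andP: (fw a).
    apply: (@le_trans _ _ (\sum_a xi a * 2)).
      by apply: ler_sum => a _; rewrite ler_wpM2l //; case/andP: (fw a).
    by rewrite -mulr_suml ler_piMl.
  apply: Or31; rewrite act_loc //; eexists; eexists; split; first exact: (pjump b ip).
  + by [].
  + by move=> a /=; rewrite sumr_ge0 // => a' _; rewrite mulr_ge0 ?stoch_ge0 ?scale_ge.
  + rewrite exchange_big /= (le_trans _ xi1) //; apply: ler_sum => a _.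
    by rewrite -mulr_sumr stoch_row mulr1.
- case=> [->|[i [s [P [M [k [r k0 v0 ->]]]]]]].
    apply: Or32; exists c; first by rewrite c0.
    case: b; last by left; exact: act_stay.
    right; exists 0%N, (store0 n), 0%N, 0%N, (n.+1 ^ 2)%:R^-1; split.
    + exact: reach0.
    + exact: init_scale_gt0.
    + by move=> a; have := trans_ge0 true (inr true) (inl (ord0, a)).
    + exact: act_start.
  have [s0 ip] := reach_store0 r; move: ip; rewrite leq_eqVlt => /orP[/eqP iE|ip].
    rewrite iE in r *; rewrite act_vec_final //; apply: Or32; eexists; last by left.
    have le : M.+1%:R <= P%:R :> rat by rewrite ler_nat (nonhalting r).
    (* The error is at least 1, which cancels the gain from register 0. *)
    have v1 : 1 + k * (1 + M%:R - P%:R) <= 1.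
      by rewrite gerDl pmulr_rle0 // subr_le0 -natr1 addrC in le *.
    have v2 : 0 <= 1 + k * (1 + M%:R - P%:R).
      rewrite -(vec_final P M k s0) sumr_ge0 // => a _.
      by rewrite mulr_ge0 //; case/andP: (fw a).
    by rewrite mulr_ge0 //= (le_trans _ c2) // ler_piMr.
  apply: Or32; exists c; first by rewrite c0.
  right; rewrite act_vec //; do 5 eexists; split; last by [].
  + exact: reachS r ip.
  + by rewrite divr_gt0 ?scale_gt0.
  + move=> a; rewrite -vec_step; last exact: iget_bound.
    by rewrite sumr_ge0 // => a' _; rewrite mulr_ge0 ?stoch_ge0 ?scale_ge.
- by rewrite act_fixpt; apply: Or33.
Qed.

End Machine.

(** * Spectral radii *)

Local Open Scope classical_set_scope.
Local Open Scope ring_scope.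

Section Spectral.
Variables (R : realType) (d : nat).
Implicit Types (A B : 'M[R]_d) (F : set 'M[R]_d).

Local Notation toC := (real_complex R).

Lemma normcE (z : R[i]) : `|z| = (Normc.normc z)%:C%C.
Proof. by case: z. Qed.

Lemma normc_real (x : R) : Normc.normc (toC x) = `|x|.
Proof. by rewrite /= expr0n /= addr0 sqrtr_sqr. Qed.

Lemma eigenvalue_exp A k z : eigenvalue (map_mx toC A) z ->
  eigenvalue (map_mx toC (A ^+ k)) (z ^+ k).
Proof.
move=> /eigenvalueP[v vA v0]; apply/eigenvalueP; exists v => //.
elim: k => [|k IHk]; first by rewrite !expr0 map_mx1 mulmx1 scale1r.
by rewrite exprSr -mulmxE map_mxM mulmxA IHk -scalemxAl vA scalerA exprSr.
Qed.

Lemma eigenvalue_real A (v : 'rV[R]_d) c : v != 0 -> v *m A = c *: v ->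
  eigenvalue (map_mx toC A) (toC c).
Proof.
move=> v0 vA; apply/eigenvalueP; exists (map_mx toC v).
  by rewrite -map_mxM vA map_mxZ.
by rewrite map_mx_eq0.
Qed.

(** Compares the l1 norms of both sides of the eigenvector equation: each column of [A] contributes
    at most [c] times the norm of [v]. *)
Lemma eigenvalue_bound A z c : (forall i j, `|A i j| <= c) ->
  eigenvalue (map_mx toC A) z -> Normc.normc z <= c *+ d.
Proof.
move=> Ac /eigenvalueP[v vA v0].
pose S := \sum_j `|v 0 j|.
have S0 : 0 < S.
  rewrite lt_def sumr_ge0 // andbT; apply: contraNneq v0 => /eqP.
  rewrite psumr_eq0 // => /allP h; apply/eqP/rowP => j; rewrite mxE.
  by apply/eqP; rewrite -normr_eq0; apply: h; rewrite mem_index_enum.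
rewrite -lecR -normcE -(ler_pM2r S0) /S mulr_sumr.
apply: (@le_trans _ _ (\sum_j \sum_i `|v 0 i| * toC c)).
  apply: ler_sum => j _; rewrite -normrM.
  have -> : z * v 0 j = \sum_i v 0 i * toC (A i j).
    have := congr1 (fun M : 'rV_d => M 0 j) vA; rewrite !mxE => <-.
    by apply: eq_bigr => i _; rewrite !mxE.
  apply: le_trans (ler_norm_sum _ _ _) _; apply: ler_sum => i _.
  by rewrite normrM ler_wpM2l // normcE lecR normc_real.
by rewrite sumr_const card_ord -mulr_suml mulrC rmorphMn /= mulrnAl.
Qed.

(** By Bernoulli's inequality the powers of [x > 1] grow at least linearly, hence without bound. *)
Lemma exp_bounded_le1 (x c : R) : 0 <= x -> (forall k, x ^+ k <= c) -> x <= 1.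
Proof.
move=> x0 xc; rewrite leNgt; apply/negP => x1.
have bern k : 1 + (x - 1) *+ k <= x ^+ k.
  elim: k => [|k IHk]; first by rewrite mulr0n addr0 expr0.
  rewrite exprS; apply: le_trans (ler_wpM2l x0 IHk).
  rewrite mulrS -subr_ge0.
  have -> : x * (1 + (x - 1) *+ k) - (1 + (x - 1 + (x - 1) *+ k)) = (x - 1) ^+ 2 *+ k by ring.
  by rewrite mulrn_wge0 ?sqr_ge0.
have x10 : 0 < x - 1 by rewrite subr_gt0.
have c0 : 0 <= c / (x - 1) by rewrite divr_ge0 ?(ltW x10) // (le_trans _ (xc 0%N)).
have := archi_boundP c0; set k := Num.bound _.
rewrite ltr_pdivrMr // mulr_natl => ck.
suff : c < c by rewrite ltxx.
apply: lt_le_trans ck _; apply: le_trans (xc k).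
by rewrite (le_trans _ (bern k)) // lerDr.
Qed.

Lemma spectral_radius_ge A z : eigenvalue (map_mx toC A) z ->
  Normc.normc z <= spectral_radius A.
Proof.
move=> ev; apply: ub_le_sup; last by exists z.
exists ((\sum_i \sum_j `|A i j|) *+ d) => _ [w ew ->].
apply: eigenvalue_bound ew => i j.
rewrite (bigD1 i) //= (bigD1 j) //= -addrA lerDl addr_ge0 ?sumr_ge0 // => k _.
by rewrite sumr_ge0.
Qed.

Lemma mx_entry_continuous (i j : 'I_d) : continuous (fun A : 'M[R]_d => A i j).
Proof. exact: coord_continuous. Qed.

Lemma mx_exp_entry_continuous k (i j : 'I_d) : continuous (fun A : 'M[R]_d => (A ^+ k) i j).
Proof.
elim: k i j => [|k IHk] i j.
  have -> : (fun A : 'M[R]_d => (A ^+ 0) i j) = fun=> (1 : 'M[R]_d) i j by [].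
  exact: cst_continuous.
move=> A; have FA : Filter (nbhs A) by exact: nbhs_filter.
have -> : (fun A : 'M[R]_d => (A ^+ k.+1) i j) =
  (fun A : 'M[R]_d => \sum_l A i l * (A ^+ k) l j).
  by apply/funext => B; rewrite exprS -mulmxE mxE.
apply: cvg_big => [|l _]; first exact: add_continuous.
apply: cvgM; last exact: IHk.
exact: mx_entry_continuous.
Qed.

Lemma closure_entry_ind (T : topologicalType) (S : set T) (f : T -> R) (P : set R) :
  continuous f -> closed P -> (forall x, S x -> P (f x)) ->
  forall x, closure S x -> P (f x).
Proof.
move=> cf cP SP x Sx; have cfP : closed (f @^-1` P).
  by apply: preimage_closed.
by have := closureS (SP : S `<=` f @^-1` P) Sx; rewrite -(closure_id _).1.
Qed.

Lemma mx_products_exp F A k : mx_products F A -> mx_products F (A ^+ k.+1).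
Proof.
move=> FA; elim: k => [|k IHk]; first by rewrite expr1.
by rewrite exprS -mulmxE; apply: mx_products_mul.
Qed.

(** Entry bounds on products hold for their powers and survive in the closure, so the powers of each
    eigenvalue stay bounded and its modulus is at most 1. The fixed row [o] also survives and
    provides the eigenvalue 1. *)
Lemma csr_of_bounded F (o : 'I_d) c :
  (forall A, mx_products F A -> forall i j, `|A i j| <= c) ->
  (forall A, mx_products F A -> forall j, A o j = (o == j)%:R) ->
  csr (mx_semigroup F).
Proof.
move=> Fc Fo; exists 1; first exact: oner_neq0.
move=> A FA.
have Ao : eigenvalue (map_mx toC A) (toC 1).
  apply: (@eigenvalue_real _ (delta_mx 0 o)).
    apply/eqP => /rowP /(_ o); rewrite !mxE !eqxx => /eqP.
    by rewrite oner_eq0.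
  apply/rowP => j; rewrite scale1r -rowE !mxE eqxx eq_sym.
  apply: (closure_entry_ind (@mx_entry_continuous o j) (@closed_eq _ _) _ FA).
  exact: (fun B FB => Fo B FB j).
apply/eqP; rewrite eq_le; apply/andP; split.
  apply: ge_sup; first by exists (Normc.normc (toC 1)), (toC 1).
  move=> _ [z ez ->].
  (* The summand 1 covers the power 0, the identity, which need not be a product. *)
  apply: (@exp_bounded_le1 _ ((1 + c) *+ d)).
    by case: z {ez} => a b; rewrite /= sqrtr_ge0.
  move=> k; have -> : Normc.normc z ^+ k = Normc.normc (z ^+ k).
    by apply: complexI; rewrite rmorphXn /= -!normcE normrX.
  apply: eigenvalue_bound (eigenvalue_exp k ez) => i j.
  apply: (closure_entry_ind (P := [set x | `|x| <= 1 + c]) (@mx_exp_entry_continuous k i j) _ _ FA).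
    by apply: (preimage_closed _ (@closed_le _ _)) => x _; exact: norm_continuous.
  move=> B FB; case: k => [|k].
    rewrite expr0 mxE.
    have c0 := le_trans (normr_ge0 _) (Fc B FB i j).
    by rewrite /= normr_nat; case: (i == j); rewrite ?lerDl ?addr_ge0.
  by apply: le_trans (Fc _ (mx_products_exp k FB) i j) _; rewrite lerDr.
have <- : Normc.normc (toC 1) = 1 by rewrite normc_real normr1.
exact: spectral_radius_ge.
Qed.

(** The powers of [A] lie in the semigroup and their spectral radii are at least the powers of [c],
    so no constant [r] equals them all. *)
Lemma not_csr_of_eigenvalue F A (v : 'rV[R]_d) c : mx_products F A ->
  v != 0 -> v *m A = c *: v -> 1 < c -> ~ csr (mx_semigroup F).
Proof.
move=> FA v0 vA c1 [r _ Fr]; move: (c1); rewrite ltNge => /negP; apply.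
have c0 : 0 <= c by rewrite (le_trans _ (ltW c1)).
apply: (@exp_bounded_le1 _ (Num.max 1 r)) => // -[|k].
  by rewrite expr0 le_max lexx.
rewrite le_max; apply/orP; right.
rewrite -(Fr (A ^+ k.+1)); last exact/subset_closure/mx_products_exp.
have := spectral_radius_ge (eigenvalue_exp k.+1 (eigenvalue_real v0 vA)).
by rewrite -rmorphXn normc_real ger0_norm // exprn_ge0.
Qed.

End Spectral.

(** * Coding the pair as a number *)

Local Open Scope nat_scope.

(** One step of [CodeSeq.code]: it puts [m] in front of the sequence coded by [acc]. *)
Definition push (m acc : nat) : nat := 2 ^ m * acc.*2.+1.

(* The entries are those of the first five states in the row of the initial
   one, namely 0, 1/q, n/q, n/q and n^2/q where q = (n + 1)^2. *)
Definition instance_code (d T n : nat) : nat :=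
  foldr push T [:: d; 0; 1; 1; n.+1 ^ 2; n; n.+1 ^ 2; n; n.+1 ^ 2; n ^ 2; n.+1 ^ 2].

(** Every number codes a sequence, so [push] is the injective cons operation. *)
Lemma push_inj d T d' T' : push d T = push d' T' -> d = d' /\ T = T'.
Proof.
have pE e U : push e U = CodeSeq.code (e :: CodeSeq.decode U).
  by rewrite -[in LHS](CodeSeq.decodeK U).
by rewrite !pE => /(can_inj CodeSeq.codeK)[-> /(can_inj CodeSeq.decodeK)].
Qed.

Local Open Scope ring_scope.

(** Products stay rational, and a property of rows preserved by both generators is preserved by
    every product, so invariants need only be checked letter by letter. *)
Lemma mx_products_rat (R : realType) d (A1 A2 : 'M[rat]_d) B :
  mx_products (rat_pair R A1 A2) B -> exists2 C, B = map_mx ratr C &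
    forall I : 'rV[rat]_d -> Prop, (forall v, I v -> I (v *m A1)) ->
      (forall v, I v -> I (v *m A2)) -> forall v, I v -> I (v *m C).
Proof.
elim=> [A [->|->]|A B' _ [C -> IC] _ [C' -> IC']].
- by exists A1.
- by exists A2.
- exists (C *m C'); first by rewrite map_mxM.
  by move=> I I1 I2 v Iv; rewrite mulmxA; apply: IC' => //; apply: IC.
Qed.

(** * Numbering the states: the c.s.r. criterion and the code of the pair *)

Section Realize.
Variables (p : seq instr) (N : nat).
Hypothesis N1 : (1 < N)%N.

Definition entry_state (j k : 'I_N) : state p N := inl (ord0, inl (inl (j, k))).

(* The states whose entries in the row of [inr true] depend on the input come
   first, so that they are at the beginning of the code of the matrix. *)
Definition lead_states : seq (state p N) :=
  let i0 := Ordinal (ltnW N1) in let i1 := Ordinal N1 in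
  [:: inr true; entry_state i0 i0; entry_state i0 i1; entry_state i1 i0; entry_state i1 i1].

Definition rest_states := [seq x <- enum {: state p N} | x \notin lead_states].

Definition states := lead_states ++ rest_states.

Lemma states_uniq : uniq states.
Proof.
rewrite cat_uniq filter_uniq ?enum_uniq // andbT; apply/andP; split => //.
by apply/hasPn => x; rewrite mem_filter => /andP[].
Qed.

Lemma mem_states x : x \in states.
Proof. by rewrite mem_cat mem_filter mem_enum andbT orbN. Qed.

Definition nstates := size states.

Definition state_of (i : 'I_nstates) : state p N := tnth (in_tuple states) i.

Lemma state_ofP x : exists i, state_of i = x.
Proof.
have xs := mem_states x; rewrite -index_mem in xs.
by exists (Ordinal xs); rewrite /state_of (tnth_nth x) nth_index ?mem_states.
Qed.

Lemma state_of_inj : injective state_of.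
Proof.
move=> i j; rewrite /state_of !(tnth_nth (inr true)) => /eqP.
by rewrite nth_uniq ?states_uniq // => /eqP /val_inj.
Qed.

Lemma sum_states (G : state p N -> rat) : \sum_(i < nstates) G (state_of i) = \sum_x G x.
Proof.
rewrite -(big_tnth _ _ states xpredT G); apply: perm_big.
rewrite uniq_perm ?states_uniq ?index_enum_uniq // => x.
by rewrite mem_states mem_index_enum.
Qed.

Definition trans_mx n b : 'M[rat]_nstates := \matrix_(i, j) trans n b (state_of i) (state_of j).

Definition row_of (f : state p N -> rat) : 'rV[rat]_nstates := \row_j f (state_of j).

Lemma row_of_mul n b f : row_of f *m trans_mx n b = row_of (act n f b).
Proof.
apply/rowP => j; rewrite !mxE /act -sum_states.
by apply: eq_bigr => i _; rewrite !mxE.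
Qed.

Definition word_mx n (w : seq bool) : 'M[rat]_nstates :=
  foldr (fun b M => trans_mx n b *m M) 1%:M w.

Lemma row_of_word n w f : row_of f *m word_mx n w = row_of (foldl (act n) f w).
Proof.
elim: w f => [|b w IHw] f /=; first by rewrite mulmx1.
by rewrite mulmxA row_of_mul IHw.
Qed.

Lemma word_mx_products (R : realType) n b w :
  mx_products (rat_pair R (trans_mx n true) (trans_mx n false))
    (map_mx ratr (word_mx n (b :: w))).
Proof.
have gen b' : mx_products (rat_pair R (trans_mx n true) (trans_mx n false))
    (map_mx ratr (trans_mx n b')).
  by apply: mx_products_gen; case: b'; [left | right].
elim: w b => [|b' w IHw] b; first by rewrite /= mulmx1.
by rewrite [word_mx _ _]/= map_mxM; apply: mx_products_mul (IHw b').
Qed.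

Lemma row_of_at_pt t c : row_of (at_pt t c) = c *: row_of (at_pt t 1).
Proof. by apply/rowP => j; rewrite !mxE /at_pt; case: ifP; rewrite ?mulr1 ?mulr0. Qed.

Lemma row_of_unit i : row_of (fun x => (state_of i == x)%:R) = delta_mx 0 i.
Proof.
by apply/rowP => j; rewrite !mxE eqxx (inj_eq state_of_inj) eq_sym.
Qed.

Hypothesis pN : all (fun a => op_bound N (iop a)) p.
Hypothesis pw : all (fun a => writes_pos (iop a)) p.
Hypothesis pjump : forall i b, (i < size p)%N -> (jump (iget p i) b i <= size p)%N.

(** A halting run gives a product with an eigenvalue greater than 1, on the row of the initial
    state. Otherwise the [good] rows bound all entries by 2, and [inr false] supplies the fixed
    row. *)
Lemma csr_trans (R : realType) n :
  csr (mx_semigroup (rat_pair R (trans_mx n true) (trans_mx n false))) <->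
  ~ exists w s', run p w 0 (store0 n) (size p) s'.
Proof.
split=> [csrA [w [s' rw]]|nh].
  have [b [w' [c [c1 E]]]] := halting_word N1 pN pw pjump rw.
  pose v : 'rV[R]_nstates := map_mx ratr (row_of (at_pt true 1)).
  have [i iE] := state_ofP (inr true).
  apply: (@not_csr_of_eigenvalue _ _ _ _ v (ratr c)) csrA.
  - exact: (word_mx_products R n b w').
  - apply/eqP => /rowP /(_ i); rewrite !mxE iE /at_pt eqxx rmorph1 => /eqP.
    by rewrite oner_eq0.
  - by rewrite -map_mxM row_of_word E row_of_at_pt map_mxZ.
  - by rewrite -(rmorph1 (@ratr R)) ltr_rat.
have nonhalting s P M : reach p (store0 n) (size p) s P M -> (M < P)%N.
  move=> /reach_run[le eq]; rewrite ltn_neqAle le andbT.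
  by apply/eqP => /eq[w rw]; apply: nh; exists w, s.
have [o oE] := state_ofP (inr false).
apply: (@csr_of_bounded R nstates _ o 2) => B /mx_products_rat[C -> IC].
  move=> i j; rewrite mxE.
  have [f [gf fE]] : exists f, good (p := p) (N := N) n f /\ row i C = row_of f.
    rewrite rowE; apply: (IC (fun v => exists f, good n f /\ v = row_of f)).
    - by move=> _ [f [gf ->]]; exists (act n f true); rewrite row_of_mul; split=> //; exact: good_act.
    - by move=> _ [f [gf ->]]; exists (act n f false); rewrite row_of_mul; split=> //; exact: good_act.
    - by exists (fun x => (state_of i == x)%:R); rewrite row_of_unit; split=> //; exact: good_unit.
  have -> : C i j = f (state_of j).
    by have := congr1 (fun M : 'rV_nstates => M 0 j) fE; rewrite !mxE.
  have /andP[f0 f2] := good_bound (state_of j) gf.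
  rewrite ger0_norm; first by rewrite -(ratr_nat R 2) ler_rat.
  by rewrite ler0q.
move=> j; rewrite mxE.
have : row o C = row_of (at_pt false 1).
  have -> : row o C = row_of (at_pt false 1) *m C.
    rewrite rowE; congr (_ *m _); apply/rowP => k.
    rewrite -row_of_unit !mxE oE /at_pt eq_sym.
    by case: ifP.
  apply: (IC (fun v => v = row_of (at_pt false 1))) => // v ->.
    by rewrite row_of_mul act_fixpt.
  by rewrite row_of_mul act_fixpt.
move=> /(congr1 (fun M : 'rV_nstates => M 0 j)); rewrite !mxE => ->.
rewrite /at_pt -oE (inj_eq state_of_inj) eq_sym.
by case: ifP => _; rewrite ?rmorph0 ?rmorph1.
Qed.

Lemma trans_mx_nonneg n b : mx_nonneg (trans_mx n b).
Proof. by move=> i j; rewrite mxE; apply: trans_ge0. Qed.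

Lemma mx_code_trans n b :
  mx_code (trans_mx n b) = flatten [seq rat_code (trans n b x y) | x <- states, y <- states].
Proof.
have sE : states = [seq state_of i | i <- enum 'I_nstates].
  by rewrite -[LHS](map_tnth_enum (in_tuple states)).
rewrite {1 2}sE allpairs_mapl allpairs_mapr; congr flatten.
by apply: eq_allpairs => i j; rewrite mxE.
Qed.

Lemma rat_code_frac a q : (0 < q)%N -> coprime a q ->
  rat_code (a%:R * q%:R^-1) = [:: a; q].
Proof.
move=> q0 aq; have E : (a%:R * q%:R^-1 : rat) = (a%:Z)%:~R / (q%:Z)%:~R by [].
rewrite /rat_code E coprimeq_num ?coprimeq_den //=.
by case: q q0 {E aq} => // q _; rewrite gtr0_sg ?mul1r.
Qed.

(** The input enters only the row of [inr true] under the letter [true]; [scale] and all other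
    transitions are free of it. *)
Lemma pair_code_trans : exists T, forall n,
  pair_code (trans_mx n true) (trans_mx n false) =
  instance_code nstates T n.
Proof.
(* This is all that follows the lead entries in the code; being the same for every [n], it can be
   read off at [n = 0]. *)
pose behind n := flatten [seq rat_code (trans n true (inr true) y) | y <- rest_states] ++
  flatten [seq rat_code (trans n true x y) | x <- behead states, y <- states] ++
  flatten [seq rat_code (trans n false x y) | x <- states, y <- states].
exists (CodeSeq.code (behind 0%N)) => n.
have -> : behind 0%N = behind n.
  congr (flatten _ ++ flatten _ ++ flatten _).
  - apply/eq_in_map => y; rewrite mem_filter => /andP[yl _]; congr rat_code.
    case: y yl => [[i a]|[]] //=; case: eqP => // i0 al.
    have {i0}iE : i = ord0 by apply: val_inj.
    rewrite {}iE in al.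
    case: a al => [[[j k]|e]|u] al.
    (* The initial store vanishes from register 2 on, so the entries depending on the input involve
       only registers 0 and 1, and their states are lead states. *)
    + have lt2 (l : 'I_N) : (l < 2)%N -> l = Ordinal (ltnW N1) \/ l = Ordinal N1.
        by case: l => [[|[|l]] lN] // _; [left | right]; apply: val_inj.
      have ge2 m l : (2 <= l)%N -> store0 m l = 0%N by case: l => [|[|l]].
      rewrite /=; case: (ltnP j 2) => j2; last by rewrite !(ge2 _ j) ?mul0n ?mulr0.
      case: (ltnP k 2) => k2; last by rewrite !(ge2 _ k) ?muln0 ?mulr0.
      by case/negP: al; case: (lt2 j j2) => ->; case: (lt2 k k2) => ->;
        rewrite !inE eqxx ?orbT.
    + by rewrite /= if_same !mulr0.
    + by rewrite !store0_slack.
  - apply/eq_in_allpairs => x y xs _; congr rat_code.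
    have : x != inr true by apply: contraTneq xs => ->; case/andP: states_uniq.
    by case: x {xs} => [[i a]|[]]; case: y => [[i' a']|u].
have q0 : (0 < n.+1 ^ 2)%N by rewrite expn_gt0.
have cq a : coprime a n.+1 -> coprime a (n.+1 ^ 2) by apply: coprimeXr.
(* The numerators 1, [n] and [n ^ 2] are coprime to [n + 1], so the fractions are in lowest
   terms. *)
have init (j k : 'I_N) a : (store0 n j * store0 n k)%N = a -> coprime a n.+1 ->
    rat_code (trans n true (inr true) (entry_state j k)) = [:: a; (n.+1 ^ 2)%N].
  by move=> ja ca; rewrite /= ja mulrC rat_code_frac // cq.
have -> : pair_code (trans_mx n true) (trans_mx n false) = CodeSeq.code
    ([:: nstates; 0; 1; 1; n.+1 ^ 2; n; n.+1 ^ 2; n; n.+1 ^ 2; n ^ 2; n.+1 ^ 2]%N ++ behind n).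
  rewrite /pair_code !mx_code_trans; congr CodeSeq.code.
  have -> : [seq rat_code (trans n true x y) | x <- states, y <- states] =
      [seq rat_code (trans n true (inr true) y) | y <- lead_states] ++
      [seq rat_code (trans n true (inr true) y) | y <- rest_states] ++
      [seq rat_code (trans n true x y) | x <- behead states, y <- states].
    by rewrite catA -map_cat.
  have lead : flatten [seq rat_code (trans n true (inr true) y) | y <- lead_states] =
      [:: 0; 1; 1; n.+1 ^ 2; n; n.+1 ^ 2; n; n.+1 ^ 2; n ^ 2; n.+1 ^ 2]%N.
    pose i0 := Ordinal (ltnW N1); pose i1 := Ordinal N1.
    have e00 := init i0 i0 1%N erefl (coprime1n _).
    have e01 := init i0 i1 n (mul1n n) (coprimenS n).
    have e10 := init i1 i0 n (muln1 n) (coprimenS n).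
    have e11 := init i1 i1 (n ^ 2)%N (mulnn n) (coprimeXl 2 (coprimenS n)).
    pose code (y : state p N) := rat_code (trans n true (inr true) y).
    rewrite -/code -[map _ _]/[:: [:: 0; 1]%N; code (entry_state i0 i0);
      code (entry_state i0 i1); code (entry_state i1 i0); code (entry_state i1 i1)].
    by rewrite /code e00 e01 e10 e11.
  have flat3 (l1 l2 l3 : seq (seq nat)) l :
      flatten (l1 ++ l2 ++ l3) ++ l = flatten l1 ++ flatten l2 ++ flatten l3 ++ l.
    by rewrite !flatten_cat -!catA.
  by rewrite flat3 lead.
by rewrite /CodeSeq.code foldr_cat.
Qed.

End Realize.

Local Open Scope nat_scope.

Lemma updS s x v w : upd (upd s x v) x w = upd s x w.
Proof. by apply/funext => y; rewrite /upd; case: eqP. Qed.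

Lemma exec_seqA c1 c2 c3 s s' : exec ((c1 ;; c2) ;; c3) s s' <-> exec (c1 ;; c2 ;; c3) s s'.
Proof.
split=> [[u [t st tu] us']|[t st [u tu us']]]; first by exists t => //; exists u.
by exists u => //; exists t.
Qed.

Lemma exec_op o c s s' : exec (Op o ;; c) s s' <-> op_ok o s /\ exec c (op_upd o s) s'.
Proof.
split=> [[t [ok ->] ts']|[ok ex]]; first by [].
by exists (op_upd o s).
Qed.

Lemma exec_star c (g : store -> store) (I : store -> Prop) :
  (forall s, I s -> I (g s)) -> (forall s s', I s -> (exec c s s' <-> s' = g s)) ->
  forall s, I s -> forall s', exec (Star c) s s' <-> exists k, s' = iter k g s.
Proof.
move=> Ig cg s Is s'.
have Ik k : I (iter k g s) by elim: k => //= k; apply: Ig.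
have ik k t : iter_rel (exec c) k s t <-> t = iter k g s.
  elim: k t => [|k IHk] t //=; split=> [[u /IHk -> /(cg _ _ (Ik k))]|->] //.
  by exists (iter k g s); [apply/IHk | apply/(cg _ _ (Ik k))].
by split=> -[k /ik]; exists k.
Qed.

(** * The diagonal program *)

Definition Guess x := Op (Zero x) ;; Star (Inc x).

Lemma exec_guess x c s s' : s 0 = 1 -> 0 < x ->
  exec (Guess x ;; c) s s' <-> exists v, exec c (upd s x v) s'.
Proof.
move=> s0 x0; rewrite exec_seqA exec_op /=.
have st u : exec (Star (Inc x)) (upd s x 0) u <-> exists k, u = upd s x k.
  rewrite (@exec_star _ (op_upd (Add x 0)) (fun s => s 0 = 1)).
  - have it k : iter k (op_upd (Add x 0)) (upd s x 0) = upd s x k.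
      elim: k => //= k ->; rewrite updS !updE eqxx; case: eqP; first by lia.
      by rewrite s0 addn1.
    by split=> -[k]; rewrite ?it => ->; exists k; rewrite ?it.
  - by move=> t t0; rewrite /= updE; case: eqP => //; lia.
  - by move=> t t' _ /=; split=> [[]|].
  - by rewrite updE; case: eqP => //; lia.
split=> [[_ [t /st[k ->] ex]]|[k ex]]; first by exists k.
by split=> //; exists (upd s x k) => //; apply/st; exists k.
Qed.

(** Register [y] counts the rounds and is tested against [z] at the end. For [w = x] each round
    doubles [x], which gives powers of 2; otherwise the loop adds a product to [x]. *)
Definition Repeat x w y z :=
  Op (Zero y) ;; Star (Op (Add x w) ;; Inc y) ;; Op (Test y z).

Lemma exec_repeat x w y z c s s' : s 0 = 1 -> 0 < x -> 0 < y ->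
  x != y -> w != y -> z != x -> z != y ->
  exec (Repeat x w y z ;; c) s s' <->
  exec c (upd (upd s y (s z)) x
    (if w == x then 2 ^ s z * s x else s x + s z * s w)) s'.
Proof.
move=> s0 x0 y0 xy wy zx zy.
have ox : (0 == x) = false by case: x x0 {xy zx}.
have oy : (0 == y) = false by case: y y0 {xy wy zy}.
pose g t := op_upd (Add y 0) (op_upd (Add x w) t).
pose u k := upd (upd s y k) x (if w == x then 2 ^ k * s x else s x + k * s w).
have uE k : iter k g (upd s y 0) = u k.
  elim: k => [|k /= ->]; apply/funext => r; rewrite /u /g /= !updE.
    case: (r =P x) => [->|//]; rewrite (negbTE xy).
    by case: eqP => _; rewrite ?mul1n ?addn0.
  rewrite !eqxx [y == x]eq_sym (negbTE xy) (negbTE wy) ox oy.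
  rewrite s0 addn1 expnS; case: (r =P y) => [->|_]; first by rewrite [y == x]eq_sym (negbTE xy).
  by case: (r =P x) => // _; case: (w == x); lia.
have st v : exec (Star (Op (Add x w) ;; Inc y)) (upd s y 0) v <-> exists k, v = u k.
  rewrite (@exec_star _ g (fun t => t 0 = 1)).
  - by split=> -[k]; rewrite ?uE => ->; exists k; rewrite ?uE.
  - by move=> t t0; rewrite /g /= !updE ox oy.
  - by move=> t t' _ /=; split=> [[v' [_ ->] [_ ->]] //|->]; exists (op_upd (Add x w) t).
  - by rewrite updE oy.
have uy k : u k y = k by rewrite /u !updE eq_sym (negbTE xy) eqxx.
have uz k : u k z = s z by rewrite /u !updE (negbTE zx) (negbTE zy).
rewrite exec_seqA exec_op; split.
  move=> [_ [t [v /st[k ->] [/= ok ->]] ex]].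
  by move: ok ex; rewrite uy uz => /eqP ->.
move=> ex; split=> //; exists (u (s z)) => //; exists (u (s z)); first by apply/st; exists (s z).
by split=> //=; rewrite uy uz.
Qed.

(** Register 4 is the accumulator and 5 the counter: first double and add 1, then one doubling per
    unit of [x]. *)
Definition Push x := Op (Add 4 4) ;; Inc 4 ;; Repeat 4 4 5 x.

Definition pushed x (s : store) := upd (upd s 5 (s x)) 4 (push (s x) (s 4)).

Lemma exec_push x c s s' : s 0 = 1 -> x != 4 -> x != 5 ->
  exec (Push x ;; c) s s' <-> exec c (pushed x s) s'.
Proof.
move=> s0 x4 x5; rewrite exec_seqA exec_op exec_seqA exec_op exec_repeat //=.
set t := upd (upd _ 5 _) 4 _.
suff -> : t = pushed x s by split=> [[_ []]|].
apply/funext => r; rewrite /t /pushed !updE /= (negbTE x4) s0 addn1 addnn.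
by case: (r =P 4) => // r4; case: (r =P 5).
Qed.

(** Registers are pushed from left to right, so the list is the reverse of the coded sequence. *)
Definition Pushes xs c := foldr (fun x c => Push x ;; c) c xs.

Definition push_regs (s : store) xs := foldl (fun s x => pushed x s) s xs.

Lemma push_regs_acc xs s : all (fun x => (x != 4) && (x != 5)) xs ->
  push_regs s xs 4 = foldl (fun acc x => push (s x) acc) (s 4) xs.
Proof.
elim: xs s => //= x xs IHxs s /andP[_ xsP]; rewrite IHxs //.
have -> : pushed x s 4 = push (s x) (s 4) by rewrite /pushed updE.
elim: xs (push _ _) xsP {IHxs} => //= y xs IHxs acc /andP[/andP[y4 y5] xsP].
have -> : pushed x s y = s y by rewrite /pushed !updE (negbTE y4) (negbTE y5).
exact: IHxs.
Qed.

Lemma exec_pushes xs c s s' : s 0 = 1 -> all (fun x => (x != 4) && (x != 5)) xs ->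
  exec (Pushes xs c) s s' <-> exec c (push_regs s xs) s'.
Proof.
move=> s0; elim: xs s s0 => // x xs IHxs s s0 /andP[/andP[x4 x5] xsP].
by rewrite -[Pushes _ _]/(Push x ;; Pushes xs c) exec_push // IHxs.
Qed.

(* Register 1 holds the input [2 ^ d * T.*2.+1]; the program guesses [T] and
   [d], computes in register 4 the code of the matrix pair with dimension [d],
   constant part [T] and this input, and runs the decision procedure on it. *)
Definition diagonal (f : murec 1) :=
  Guess 2 ;; Guess 3 ;; Op (Zero 4) ;; Op (Add 4 2) ;; Push 3 ;; Op (Test 4 1) ;;
  Op (Zero 7) ;; Repeat 7 1 8 1 ;;
  Op (Zero 6) ;; Op (Add 6 7) ;; Op (Add 6 1) ;; Op (Add 6 1) ;; Inc 6 ;;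
  Op (Zero 9) ;; Op (Zero 4) ;; Op (Add 4 2) ;;
  Pushes [:: 6; 7; 6; 1; 6; 1; 6; 0; 0; 9; 3]
    (compile f [:: 4] 10 ;; Op (Test 10 0)).

(** The test against register 1 leaves only the guesses coded by the input, and the last test lets
    the program finish only if [f] answers 1. *)
Lemma exec_diagonal f n :
  (exists s', exec (diagonal f) (store0 n) s') <->
  exists T d, push d T = n /\ murec_eval f [tuple instance_code d T n] 1.
Proof.
(* Registers 6, 7 and 9 hold [(n + 1)^2], [n^2] and 0, in the unsimplified form left by symbolic
   execution. *)
have code_of (u : store) T d : u 0 = 1 -> u 1 = n -> u 3 = d -> u 4 = T ->
    u 6 = 0 + (0 + n * n) + n + n + 1 -> u 7 = 0 + n * n -> u 9 = 0 ->
    push_regs u [:: 6; 7; 6; 1; 6; 1; 6; 0; 0; 9; 3] 4 = instance_code d T n.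
  move=> u0 u1 u3 u4 u6 u7 u9; rewrite push_regs_acc //= u0 u1 u3 u4 u6 u7 u9.
  have -> : 0 + (0 + n * n) + n + n + 1 = n.+1 ^ 2 by rewrite -[n.+1 ^ 2]mulnn; lia.
  by rewrite add0n mulnn.
pose rest := compile f [:: 4] 10 ;; Op (Test 10 0).
have main T d : exists t : store, [/\ t 0 = 1, t 4 = instance_code d T n & forall s',
  exec (Op (Zero 4) ;; Op (Add 4 2) ;; Push 3 ;; Op (Test 4 1) ;;
    Op (Zero 7) ;; Repeat 7 1 8 1 ;;
    Op (Zero 6) ;; Op (Add 6 7) ;; Op (Add 6 1) ;; Op (Add 6 1) ;; Inc 6 ;;
    Op (Zero 9) ;; Op (Zero 4) ;; Op (Add 4 2) ;;
    Pushes [:: 6; 7; 6; 1; 6; 1; 6; 0; 0; 9; 3] rest)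
    (upd (upd (store0 n) 2 T) 3 d) s' <->
  push d T = n /\ exec rest t s'].
  eexists; split; last first.
  - move=> s'; do 2!rewrite exec_op.
    rewrite exec_push // exec_op.
    rewrite exec_op exec_repeat //.
    do 8!rewrite exec_op.
    rewrite exec_pushes //.
    split.
      move=> [_ [_ [/eqP ok [_ [_ [_ [_ [_ [_ [_ [_ [_ ex]]]]]]]]]]]].
      split.
        exact: ok.
      exact: ex.
    by move=> [/eqP ok ex].
  - by apply: code_of.
  - by [].
have args10 : all (fun x => x < 10) [:: 4] by [].
split=> [[s']|[T [d [nE ev]]]].
  rewrite exec_guess // => -[T]; rewrite exec_guess // => -[d].
  have [t [t0 t4 ->]] := main T d; rewrite /rest.
  move=> [nE [u tu [/= /eqP u10 _]]]; exists T, d; split => //.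
  have [//|ev ag] := compile_sound t0 _ args10 tu.
  have := ev [tuple instance_code d T n].
  by rewrite u10 ag // t0; apply; rewrite [RHS]/= t4.
have [t [t0 t4 eq]] := main T d.
have tE : tval [tuple instance_code d T n] = map t [:: 4] by rewrite /= t4.
have [//|u tu] := compile_complete t0 _ args10 tE ev.
have [//|u10 ag] := compile_spec t0 _ args10 tE ev tu.
exists u; rewrite exec_guess //; exists T; rewrite exec_guess //; exists d.
by apply/eq; split => //; exists u => //; split; rewrite //= u10 ag // t0.
Qed.

(** * The diagonal argument *)

Theorem theorem8 (R : realType) :
  ~ exists f : murec 1,
      forall (d : nat) (A1 A2 : 'M[rat]_d),
        (0 < d)%N -> mx_nonneg A1 -> mx_nonneg A2 ->
        (csr (mx_semigroup (rat_pair R A1 A2)) ->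
           murec_eval f [tuple pair_code A1 A2] 1) /\
        (~ csr (mx_semigroup (rat_pair R A1 A2)) ->
           murec_eval f [tuple pair_code A1 A2] 0).
Proof.
move=> [f decides].
have [p [runE pw pjump]] : exists p, [/\
    forall n, (exists w s', run p w 0 (store0 n) (size p) s') <->
      exists s', exec (diagonal f) (store0 n) s',
    all (fun a => writes_pos (iop a)) p &
    forall i b, i < size p -> jump (iget p i) b i <= size p].
  exists (flat (diagonal f) 0); split.
  - by move=> n; apply: iff_sym; exact: flat_exec.
  - by apply: flat_writes_pos; rewrite /= compile_writes_pos.
  - move=> i b; exact: (@flat_jump (diagonal f) 0 b i).
have [N N1 pN] := bound_exists p.
have [T [d codeE]] : exists T d, forall n, pair_code (trans_mx p N1 n true)
    (trans_mx p N1 n false) = instance_code d T n.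
  by have [T codeE] := pair_code_trans p N1; exists T, (nstates p N1).
(* The program, and with it [d] and [T], is independent of the input, which can therefore be chosen
   to code [d] and [T] themselves. *)
have [n nE] : exists n, push d T = n by exists (push d T).
have [acc rej] := decides (nstates p N1) _ _ (ltn0Sn _)
  (@trans_mx_nonneg p N N1 n true) (@trans_mx_nonneg p N N1 n false).
have csrE := csr_trans N1 pN pw pjump R n.
have haltE : (exists w s', run p w 0 (store0 n) (size p) s') <->
    murec_eval f [tuple instance_code d T n] 1.
  rewrite runE exec_diagonal; split=> [[T' [d' []]]|ev]; last by exists T, d.
  by rewrite -nE => /push_inj[-> ->].
rewrite codeE in acc rej.
(* If the pair is c.s.r., [f] answers 1 and the program halts, so the pair is not c.s.r. Otherwise
   the program halts, so [f] answers both 1 and 0. *)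
have [c|nc] := EM (csr (mx_semigroup (rat_pair R (trans_mx p N1 n true) (trans_mx p N1 n false)))).
  by apply: (csrE.1 c); apply/haltE/acc.
suff /haltE/murec_eval_fun/(_ (rej nc)) : exists w s', run p w 0 (store0 n) (size p) s' by [].
by apply: contrapT => nh; apply/nc/csrE.
Qed.
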